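(* Let $1\le p<\infty$, $0<q<\infty$, let $v,w$ be weights on $\mathbb R$ such that $\int_x^\infty w(t)\,dt<\infty$ for every $x\in\mathbb R$, and let $U$ be a regular kernel on $\mathbb R\times\mathbb R$. Then the following three statements are equivalent. (i) There exists a constant $C_1$ such that $$\Big(\int_{-\infty}^\infty\Big(\operatorname*{ess\,sup}_{-\infty<y\le x}U(y,x)\int_{-\infty}^yf(t)\,dt\Big)^qw(x)\,dx\Big)^{1/q}\le C_1\Big(\int_{-\infty}^\infty f(t)^pv(t)\,dt\Big)^{1/p}$$ for every nonnegative measurable function $f$ on $\mathbb R$. (ii) There exists a constant $C_2$ such that $$\Big(\int_{-\infty}^\infty\Big(\int_{-\infty}^xU(y,x)^pf(y)\,dy\Big)^{q/p}w(x)\,dx\Big)^{p/q}\le C_2\int_{-\infty}^\infty f(x)\,\sigma_p(-\infty,x)^{-p}\,dx$$ for every nonnegative measurable function $f$ on $\mathbb R$. (iii) There exists a constant $C_3$ such that $$\Big(\int_{-\infty}^\infty\Big(\operatorname*{ess\,sup}_{-\infty<y\le x}U(y,x)^p\int_{-\infty}^yf(t)\,dt\Big)^{q/p}w(x)\,dx\Big)^{p/q}\le C_3\int_{-\infty}^\infty f(x)\,\sigma_p(-\infty,x)^{-p}\,dx$$ for every nonnegative measurable function $f$ on $\mathbb R$. Moreover, if $C_1,C_2,C_3$ are the best constants in these inequalities, then $C_1\approx C_2^{1/p}\approx C_3^{1/p}$.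
   Context: A weight on $\mathbb R$ is a nonnegative measurable function on $\mathbb R$. A function $U\colon\mathbb R\times\mathbb R\to[0,\infty)$ is a regular kernel if it is nonincreasing in the first variable, nondecreasing in the second variable, and there is a positive constant $c$ (the constant of regularity) with $U(x,z)\le c(U(x,y)+U(y,z))$ for all real $x\le y\le z$. For $-\infty\le a<b$, $\sigma_p(a,b)=\big(\int_a^bv(y)^{1-p'}\,dy\big)^{1/p'}$ if $1<p<\infty$, where $p'=\frac p{p-1}$, and $\sigma_1(a,b)=\operatorname{ess\,sup}_{a<y<b}v(y)^{-1}$. $A\approx B$ means $c_1A\le B\le c_2A$ with positive constants $c_1,c_2$ depending only on $p$, $q$ and the constant of regularity of $U$. Integrals take values in $[0,\infty]$; $0\cdot\infty=0$, $0^{-s}=\infty$, $\infty^{-s}=0$ for $s>0$. *)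

(* Defs.v *)
From HB Require Import structures.
From mathcomp Require Import all_boot all_order all_algebra.
From mathcomp Require Import all_classical all_reals all_analysis ess_sup_inf.

Set Implicit Arguments.
Unset Strict Implicit.
Unset Printing Implicit Defensive.

Import Order.TTheory GRing.Theory Num.Theory.
Import numFieldNormedType.Exports.

Local Open Scope classical_set_scope.
Local Open Scope ring_scope.
Local Open Scope ereal_scope.

(* The type [R] with the sigma-algebra of Lebesgue (i.e. Caratheodory)
   measurable sets, which strictly contains the Borel one carried by [R]. *)
Definition lebesgueR (R : realType) : measurableType _ :=
  caratheodory_type ((@wlength R idfun)^*)%mu.

Notation leb := completed_lebesgue_measure.

Section defs.
Context {R : realType}.
Implicit Types (p q c C : R) (v w f g : R -> R) (U : R -> R -> R).

Definition nonneg_measurable f :=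
  (forall x, (0 <= f x)%R) /\
  measurable_fun [set: lebesgueR R] (f : lebesgueR R -> R).

(* [x ^ (- s)] for [s > 0], with [0 ^ (- s) = +oo] and [+oo ^ (- s) = 0]:
   [inve] obeys these two conventions, whereas [poweR x (- s)] does not. *)
Definition negpow (x : \bar R) (s : R) : \bar R := (x `^ s)^-1.

(* Essential supremum over [D]. Extension by 0 outside [D] is harmless, since
   this is only used for [h >= 0] and [D] of positive measure. *)
Definition ess_sup_on (D : set R) (h : R -> \bar R) : \bar R :=
  ess_sup leb (h \_ D).

Definition regular_kernel_with c U :=
  [/\ (0 < c)%R,
      (forall x y, 0 <= U x y)%R,
      (forall y x1 x2, x1 <= x2 -> U x2 y <= U x1 y)%R,
      (forall x y1 y2, y1 <= y2 -> U x y1 <= U x y2)%R &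
      (forall x y z, x <= y -> y <= z -> U x z <= c * (U x y + U y z))%R].

Definition regular_kernel U := exists c, regular_kernel_with c U.

Definition conj_exp p : R := (p / (p - 1))%R.

(* The exponent [1 - p'] is negative and is written [- (p' - 1)]. *)
Definition sigma p v (a b : \bar R) : \bar R :=
  let I := [set y : R | a < y%:E < b] in
  if p == 1%R then ess_sup_on I (fun y => negpow (v y)%:E 1)
  else (\int[leb]_(y in I) negpow (v y)%:E (conj_exp p - 1)) `^ (conj_exp p)^-1.

Definition norm_pv p v f : \bar R :=
  (\int[leb]_t ((f t `^ p)%R * v t)%:E) `^ p^-1.

Definition norm_sigma p v f : \bar R :=
  \int[leb]_x ((f x)%:E * negpow (sigma p v -oo x%:E) p).

Definition inequality_i p q v w U C :=
  forall f, nonneg_measurable f ->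
    (\int[leb]_x
       ((ess_sup_on `]-oo, x]
           (fun y => (U y x)%:E * \int[leb]_(t in `]-oo, y]) (f t)%:E)) `^ q
        * (w x)%:E)) `^ q^-1
    <= C%:E * norm_pv p v f.

Definition inequality_ii p q v w U C :=
  forall f, nonneg_measurable f ->
    (\int[leb]_x
       ((\int[leb]_(y in `]-oo, x]) ((U y x `^ p)%R * f y)%:E) `^ (q / p)
        * (w x)%:E)) `^ (p / q)
    <= C%:E * norm_sigma p v f.

Definition inequality_iii p q v w U C :=
  forall f, nonneg_measurable f ->
    (\int[leb]_x
       ((ess_sup_on `]-oo, x]
           (fun y => (U y x `^ p)%:E * \int[leb]_(t in `]-oo, y]) (f t)%:E))
          `^ (q / p)
        * (w x)%:E)) `^ (p / q)
    <= C%:E * norm_sigma p v f.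

(* Best nonnegative constant; it is [+oo] when no constant is admissible. *)
Definition best_constant (ineq : R -> Prop) : \bar R :=
  ereal_inf [set C%:E | C in [set C : R | (0 <= C)%R /\ ineq C]].

Definition equiv_const (c1 c2 : R) (A B : \bar R) :=
  c1%:E * A <= B /\ B <= c2%:E * A.

End defs.

(* Main.v *)
Require Import Defs.
From mathcomp Require Import all_boot all_order all_algebra.
From mathcomp Require Import all_classical all_reals all_analysis ess_sup_inf measurable_realfun.
From mathcomp Require Import ring lra.

Set Implicit Arguments.
Unset Strict Implicit.
Unset Printing Implicit Defensive.

Import Order.TTheory GRing.Theory Num.Theory.
Import numFieldNormedType.Exports.

Local Open Scope classical_set_scope.
Local Open Scope ring_scope.
Local Open Scope ereal_scope.

(** Write [om x] for [sigma_p(-oo, x)^(-p)], [prim f] for the primitive of [f]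
   from [-oo], [K] for [U ^ p] and [r] for [q / p].  Up to powers, each of the
   three inequalities bounds an integral against [w] of an operator applied to
   [f], by the price of [f]: its price is the integral of [f ^ p * v] in (i)
   and that of [f * om] in (ii) and (iii).

   (ii) implies (iii): [K] decreases in its first variable, so that
   [K y x * prim f y] is at most the integral of [K t x * f t] over [t <= y]
   ([supop_le_kop]).

   (i) and (iii): Hoelder's inequality says that a mass [m] spread over
   [`]-oo, b]] has [p]-th power price at least [m ^ p * om b]
   ([sigma_hoelder_bound]), and the inequality is sharp
   ([sigma_hoelder_sharp]).  Cut the line at the points [s_k] where [prim f]
   reaches the levels [l_k = eta * 2 ^ k].  To go from (i) to (iii), take the
   largest of near-extremal functions with mass [l_k ^ (1 / p)] to the left of
   [s_k]; the [p]-th power of its primitive dominates [prim f] up to constants,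
   and its price is at most the sum of the [l_k * om s_k], where
   [l_k * om s_k] is at most twice the integral of [f * om] between [s_(k-1)]
   and [s_k] because [om] decreases ([pow_primitive]).  To go from (iii) to (i),
   put a mass [l_k ^ p] just to the right of [s_k]; the price
   [l_k ^ p * om s_k] is bounded by the Hoelder inequality on
   [`]s_(k-1), s_k]] ([primitive_pow]).  In both cases it is enough to test the
   given inequality on the new function.

   (iii) implies (ii): take points [x_k] beyond which the mass of [w] is
   [a ^ (- k)] times its total mass.  By regularity of [K], the integral
   operator at [x_(k+1)] is at most a constant times its value at [x_k], plus
   a constant times [K x_k x_(k+1) * prim f x_k], plus the integral of
   [K y x_(k+1) * f y] over [`]x_k, x_(k+1)]].  The second term is at most
   the supremum operator at [x_(k+1)].  So is the third, once the mass that [f] carries on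
   the interval has been gathered at a place where [K] is large compared with
   [om]; an averaging argument gives such a place ([concentrate_mass]).  The
   first term is absorbed because [a] is chosen so large that the geometric
   decay of the weight beats the growth constant ([kop_supop_step]).

   These constructions are made for bounded [f] vanishing far away (and, in the
   last implication, for such [w] as well), up to additive errors; truncation
   and Fatou's lemma ([fatou_pow]) remove both restrictions.  The constants obtained depend on [p], [q] and the constant
   of regularity alone, which gives the comparison of the best constants
   ([best_constant_transfer]). *)

(** * Measurability and integration of nonnegative functions *)
Section base.
Context {R : realType}.
Implicit Types (f g h v w : R -> R) (F G : R -> \bar R) (A B D : set R).

Definition mset A := @measurable _ (lebesgueR R) A.

Definition emeas F := @measurable_fun _ _ (lebesgueR R) (\bar R) setT F.

Lemma mset_borel A : measurable A -> mset A.
Proof. by move=> mA; apply: sub_caratheodory; exact: mA. Qed.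

Lemma mset_itv (i : interval R) : mset [set` i].
Proof. by apply: mset_borel; exact: measurable_itv. Qed.
Hint Resolve mset_itv : core.

Lemma mset_T : mset setT.
Proof. exact: measurableT. Qed.
Hint Resolve mset_T : core.

Lemma leb_oc (a b : R) : (a <= b)%R -> leb `]a, b] = (b - a)%:E.
Proof.
move=> ab; have -> : leb `]a, b] = lebesgue_measure `]a, b] by [].
rewrite lebesgue_measure_itv/= lte_fin.
by case: ltgtP ab => // ->; rewrite subrr.
Qed.

Lemma leb_set1 (a : R) : leb [set a] = 0.
Proof. exact: lebesgue_measure_set1. Qed.

Lemma mset_set1 (a : R) : mset [set a].
Proof. exact: mset_borel. Qed.

Lemma leb_setT : 0 < leb [set: lebesgueR R].
Proof.
apply: (@lt_le_trans _ _ (leb `]0%R, 1%R])).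
  by rewrite leb_oc// subr0 lte01.
by apply: le_measure; rewrite ?inE//; exact: mset_itv.
Qed.

(** The preimage of a ray under a monotone function is an interval. *)
Lemma emeas_homo F :
  {homo F : x y / (x <= y)%R >-> x <= y} -> emeas F.
Proof.
move=> ndF.
apply: (measurability _ (ErealGenOInfty.measurableE R)).
move=> _ [_ [r ->] <-]; rewrite setTI.
apply: mset_borel; apply: is_interval_measurable => x y /= Fx Fy z /andP[xz zy].
move: Fx; rewrite /= !in_itv/= !andbT => Fx.
exact: (lt_le_trans Fx (ndF _ _ xz)).
Qed.

Lemma emeas_nhomo F :
  {homo F : x y / (x <= y)%R >-> y <= x} -> emeas F.
Proof.
move=> niF.
apply: (measurability _ (ErealGenOInfty.measurableE R)).
move=> _ [_ [r ->] <-]; rewrite setTI.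
apply: mset_borel; apply: is_interval_measurable => x y /= Fx Fy z /andP[xz zy].
move: Fy; rewrite /= !in_itv/= !andbT => Fy.
exact: (lt_le_trans Fy (niF _ _ zy)).
Qed.

Lemma emeasM F G : emeas F -> emeas G -> emeas (fun x => F x * G x).
Proof. exact: emeasurable_funM. Qed.

Lemma emeasD F G : emeas F -> emeas G -> emeas (fun x => F x + G x).
Proof. exact: emeasurable_funD. Qed.

Lemma emeas_pow F (s : R) : emeas F -> emeas (fun x => F x `^ s).
Proof. by move=> mF; apply: (measurableT_comp (measurable_poweR s)). Qed.

Lemma emeas_fin f : nonneg_measurable f -> emeas (fun x => (f x)%:E).
Proof. by move=> [_ mf]; exact/measurable_EFinP. Qed.

Lemma nnmM f g :
  nonneg_measurable f -> nonneg_measurable g ->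
  nonneg_measurable (fun x => f x * g x)%R.
Proof.
move=> [f0 mf] [g0 mg]; split; first by move=> x; rewrite mulr_ge0.
exact: measurable_funM.
Qed.

Lemma nnmD f g :
  nonneg_measurable f -> nonneg_measurable g ->
  nonneg_measurable (fun x => f x + g x)%R.
Proof.
move=> [f0 mf] [g0 mg]; split; first by move=> x; rewrite addr_ge0.
exact: measurable_funD.
Qed.

Lemma nnm_pow f (s : R) :
  nonneg_measurable f -> nonneg_measurable (fun x => f x `^ s)%R.
Proof.
move=> [f0 mf]; split; first by move=> x; rewrite powR_ge0.
by apply: (measurableT_comp (measurable_powR s)).
Qed.

Lemma nnm_max f g :
  nonneg_measurable f -> nonneg_measurable g ->
  nonneg_measurable (fun x => Num.max (f x) (g x))%R.
Proof.
move=> [f0 mf] [g0 mg]; split; first by move=> x; rewrite le_max f0.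
exact: measurable_maxr.
Qed.

Lemma nnm_cst (c : R) : (0 <= c)%R -> nonneg_measurable (fun _ : R => c).
Proof. by move=> c0; split => //; exact: measurable_cst. Qed.

Lemma nnm_indic A : mset A -> nonneg_measurable (\1_A : R -> R).
Proof.
move=> mA; split; first by move=> x; rewrite indicE.
exact: (@measurable_indic _ (lebesgueR R)).
Qed.

Lemma nnm_nhomo f : (forall x, 0 <= f x)%R ->
  {homo f : x y / (x <= y)%R >-> (y <= x)%R} -> nonneg_measurable f.
Proof.
move=> f0 nf; split => //; apply/measurable_EFinP.
by apply: (@emeas_nhomo (EFin \o f)) => x y xy; rewrite lee_fin nf.
Qed.

Lemma le_int D F G : mset D -> emeas F -> emeas G ->
  (forall x, D x -> 0 <= F x) -> (forall x, D x -> F x <= G x) ->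
  \int[leb]_(x in D) F x <= \int[leb]_(x in D) G x.
Proof.
move=> mD mF mG F0 FG; apply: ge0_le_integral => //; exact: measurable_funTS.
Qed.

Lemma le_int_sub A B F : mset A -> mset B -> emeas F ->
  (forall x, 0 <= F x) -> A `<=` B ->
  \int[leb]_(x in A) F x <= \int[leb]_(x in B) F x.
Proof.
move=> mA mB mF F0 AB; apply: ge0_subset_integral => //.
exact: measurable_funTS.
Qed.

Lemma intD D F G : mset D -> emeas F -> emeas G ->
  (forall x, 0 <= F x) -> (forall x, 0 <= G x) ->
  \int[leb]_(x in D) (F x + G x) =
  \int[leb]_(x in D) F x + \int[leb]_(x in D) G x.
Proof.
move=> mD mF mG F0 G0; apply: ge0_integralD => //; exact: measurable_funTS.
Qed.

Lemma intZ D F k : mset D -> emeas F -> (forall x, 0 <= F x) -> 0 <= k ->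
  \int[leb]_(x in D) (k * F x) = k * \int[leb]_(x in D) F x.
Proof.
move=> mD mF F0 k0; apply: ge0_integralZl => //; exact: measurable_funTS.
Qed.

Lemma int_split A B F : mset A -> mset B -> emeas F -> (forall x, 0 <= F x) ->
  (forall x, A x -> B x -> False) ->
  \int[leb]_(x in A `|` B) F x =
  \int[leb]_(x in A) F x + \int[leb]_(x in B) F x.
Proof.
move=> mA mB mF F0 AB; apply: ge0_integral_setU => //.
  exact: measurable_funTS.
by apply/disj_setPS => x [] /AB /[apply].
Qed.

Lemma int_itvNyc_split (a b : R) F : (a <= b)%R -> emeas F -> (forall x, 0 <= F x) ->
  \int[leb]_(x in `]-oo, b]) F x =
  \int[leb]_(x in `]-oo, a]) F x + \int[leb]_(x in `]a, b]) F x.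
Proof.
move=> ab mF F0; rewrite -int_split//.
- congr (integral _ _ _); apply/seteqP; split => x /=; rewrite !in_itv/=.
    by move=> xb; case: (leP x a) => xa; [left|right; apply/andP].
  by case=> [/le_trans->//|/andP[]].
- by move=> x /=; rewrite !in_itv/= => xa /andP[]; rewrite ltNge xa.
Qed.

Lemma mule_int_itvNyc_split (k : \bar R) (a b : R) F :
  (a <= b)%R -> emeas F -> (forall x, 0 <= F x) ->
  k * \int[leb]_(x in `]-oo, b]) F x =
  k * \int[leb]_(x in `]-oo, a]) F x + k * \int[leb]_(x in `]a, b]) F x.
Proof.
by move=> ab mF F0; rewrite (int_itvNyc_split ab)//; apply: ge0_muleDr; exact: integral_ge0.
Qed.

Lemma int_null_sub A B F : mset A -> mset B -> emeas F -> (forall x, 0 <= F x) ->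
  leb B = 0 -> \int[leb]_(x in A `|` B) F x = \int[leb]_(x in A) F x.
Proof.
move=> mA mB mF F0 B0; transitivity (\int[leb]_(x in (A `|` B) `\` B) F x).
  apply: ge0_negligible_integral => //; last exact: measurable_funTS.
  exact: measurableU.
rewrite setDUl setDv setU0; apply/esym; apply: ge0_negligible_integral => //.
exact: measurable_funTS.
Qed.

(** * Primitives *)
Definition prim f (y : R) : \bar R := \int[leb]_(t in `]-oo, y]) (f t)%:E.

Lemma prim_ge0 f y : nonneg_measurable f -> 0 <= prim f y.
Proof. by case=> f0 _; apply: integral_ge0 => x _; rewrite lee_fin. Qed.

Lemma prim_homo f : nonneg_measurable f ->
  {homo prim f : x y / (x <= y)%R >-> x <= y}.
Proof.
move=> nf x y xy; apply: le_int_sub => //; first exact: emeas_fin.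
  by move=> t; rewrite lee_fin nf.1.
by move=> t /=; rewrite !in_itv/= => /le_trans->.
Qed.

Lemma le_prim f g y : nonneg_measurable f -> nonneg_measurable g ->
  (forall x, f x <= g x)%R -> prim f y <= prim g y.
Proof.
move=> nf ng fg; apply: le_int => //; try exact: emeas_fin.
  by move=> x _; rewrite lee_fin nf.1.
by move=> x _; rewrite lee_fin.
Qed.

(** Left continuity of the primitive: a point has measure zero.  This is what
   makes the essential supremum below a true supremum. *)
Lemma prim_left f (y : R) (a : \bar R) : nonneg_measurable f -> a < prim f y ->
  exists2 z, (z < y)%R & a < prim f z.
Proof.
move=> nf afy.
pose I (n : nat) : set (lebesgueR R) := `]-oo, (y - n.+1%:R^-1)%R]%classic.
have cI : \int[leb]_(t in I n) (f t)%:E @[n --> \oo] --> prim f y.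
  have <- : \int[leb]_(t in \bigcup_n I n) (f t)%:E = prim f y.
    rewrite -(@int_null_sub _ [set y])//.
    - congr (integral _ _ _); apply/seteqP; split => x /=.
        case=> [[n _]|->]; rewrite /I /= !in_itv/= ?lexx// => /le_trans; apply.
        by rewrite lerBlDr lerDl.
      rewrite in_itv/= le_eqVlt => /predU1P[->|xy]; first by right.
      left; have [n nxy] := ltr_add_invr xy.
      by exists n => //; rewrite /I /= in_itv/= lerBrDr ltW.
    - by apply: bigcup_measurable => n _; exact: mset_itv.
    - exact: mset_set1.
    - exact: emeas_fin.
    - by move=> x; rewrite lee_fin nf.1.
    - exact: leb_set1.
  apply: ge0_nondecreasing_set_cvg_integral.
  - move=> m n mn; apply/subsetPset => x; rewrite /I /= !in_itv/= => /le_trans.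
    apply; rewrite lerB// lef_pV2 ?posrE// ler_nat//.
  - by move=> n; exact: mset_itv.
  - by move=> n; apply: measurable_funTS; exact: emeas_fin.
  - by move=> n x _; rewrite lee_fin nf.1.
have [n _ /(_ n (leqnn n)) an] := cI _ (open_nbhs_nbhs (conj (@open_ereal_gt_ereal _ a) afy)).
by exists (y - n.+1%:R^-1)%R => //; rewrite ltrBlDr ltrDl.
Qed.

(** * The supremum operator *)
(** A lower bound on an essential supremum requires a set of positive measure:
   here a half-open interval. *)
Lemma ess_sup_on_ge (x y z : R) (h : R -> \bar R) (a : \bar R) :
  (z < y)%R -> (y <= x)%R -> (forall t, (z < t <= y)%R -> a <= h t) ->
  a <= ess_sup_on `]-oo, x] h.
Proof.
move=> zy yx ah; rewrite leNgt; apply/negP => lta.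
have [N [mN N0 subN]] := ess_sup_ge (@leb R) (h \_ `]-oo, x]).
have : leb `]z, y] <= leb N.
  apply: le_measure; rewrite ?inE//; first exact: mset_itv.
  move=> t /= tzy; apply: subN => /=; apply/negP; rewrite -ltNge.
  apply: (lt_le_trans lta); rewrite patchE mem_set.
    by apply: ah; move: tzy; rewrite /= in_itv.
  by move: tzy; rewrite /= !in_itv/= => /andP[_ /le_trans->].
by rewrite N0 leb_oc ?(ltW zy)// lee_fin subr_le0 leNgt zy.
Qed.

Lemma ess_sup_on_le (x : R) (h : R -> \bar R) (M : \bar R) :
  0 <= M -> (forall y, (y <= x)%R -> h y <= M) -> ess_sup_on `]-oo, x] h <= M.
Proof.
move=> M0 hM; apply/ess_supP; apply: aeW => y; rewrite patchE.
by case: ifPn => // /set_mem /=; rewrite in_itv/=; exact: hM.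
Qed.

Section kernel.
Variable U : R -> R -> R.
Hypothesis U0 : (forall y x, 0 <= U y x)%R.
Hypothesis U1 : (forall x y1 y2, y1 <= y2 -> U y2 x <= U y1 x)%R.
Hypothesis U2 : (forall y x1 x2, x1 <= x2 -> U y x1 <= U y x2)%R.

Definition supop f (x : R) : \bar R :=
  ess_sup_on `]-oo, x] (fun y => (U y x)%:E * prim f y).

(** The essential supremum is attained as a pointwise supremum: [prim f] is
   left continuous and [U] decreases in its first variable, so that just to
   the left of [y] the product is at least as large as any number smaller than
   its value at [y]. *)
Lemma supop_ge f y x : nonneg_measurable f -> (y <= x)%R ->
  (U y x)%:E * prim f y <= supop f x.
Proof.
move=> nf yx.
have Tge z : (z < y)%R -> (U y x)%:E * prim f z <= supop f x.
  move=> zy; apply: (@ess_sup_on_ge _ y z) => // t /andP[zt ty].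
  apply: lee_pmul; rewrite ?lee_fin ?U0 ?prim_ge0 ?U1//.
  by apply: prim_homo => //; exact: ltW.
have T0 : 0 <= supop f x.
  apply: le_trans (Tge (y - 1)%R _); last by rewrite ltrBlDr ltrDl.
  by rewrite mule_ge0 ?lee_fin ?prim_ge0.
have := U0 y x; rewrite le_eqVlt => /predU1P[<-|Upos]; first by rewrite mul0e.
rewrite -lee_pdivlMl// leNgt; apply/negP => /(prim_left nf)[z zy].
by rewrite ltNge lee_pdivlMl// Tge.
Qed.

Lemma supop_ge0 f x : nonneg_measurable f -> 0 <= supop f x.
Proof.
move=> nf; apply: le_trans (supop_ge nf (lexx x)).
by rewrite mule_ge0 ?lee_fin ?prim_ge0.
Qed.

Lemma supop_le f x M : 0 <= M ->
  (forall y, (y <= x)%R -> (U y x)%:E * prim f y <= M) -> supop f x <= M.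
Proof. exact: ess_sup_on_le. Qed.

Lemma supop_lt f x a : 0 <= a -> a < supop f x ->
  exists2 y, (y <= x)%R & a < (U y x)%:E * prim f y.
Proof.
move=> a0; apply: contraPP => nex; apply/negP; rewrite -leNgt.
apply: supop_le => // y yx; rewrite leNgt; apply/negP => ay.
by apply: nex; exists y.
Qed.

Lemma supop_homo f : nonneg_measurable f ->
  {homo supop f : x y / (x <= y)%R >-> x <= y}.
Proof.
move=> nf x x' xx'; apply: supop_le; first exact: supop_ge0.
move=> y yx; apply: le_trans (supop_ge nf (le_trans yx xx')).
by apply: lee_pmul; rewrite ?lee_fin ?prim_ge0 ?U2.
Qed.

Lemma le_supop f g x : nonneg_measurable f -> nonneg_measurable g ->
  (forall t, f t <= g t)%R -> supop f x <= supop g x.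
Proof.
move=> nf ng fg; apply: supop_le; first exact: supop_ge0.
move=> y yx; apply: le_trans (supop_ge ng yx).
by apply: lee_pmul; rewrite ?lee_fin ?prim_ge0 ?le_prim.
Qed.

End kernel.

(** * Passage to the limit *)
Lemma limn_einf_lb (u : nat -> \bar R) (a : \bar R) (n : nat) :
  (forall m, (n <= m)%N -> a <= u m) -> a <= limn_einf u.
Proof.
move=> au; rewrite limn_einf_lim; apply: lime_ge; first exact: is_cvg_einfs.
exists n => // m /= nm; apply: le_ereal_inf_tmp => _ [k /= mk <-].
by apply: au; exact: leq_trans mk.
Qed.

Lemma limn_einf_ub (u : nat -> \bar R) (M : \bar R) :
  (forall m, u m <= M) -> limn_einf u <= M.
Proof.
move=> uM; rewrite limn_einf_lim; apply: lime_le; first exact: is_cvg_einfs.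
near=> n; apply: le_trans (uM n); apply: ereal_inf_lbound; exists n => //=.
Unshelve. all: by end_near. Qed.

Lemma poweR_le (x y : \bar R) (s : R) : (0 <= s)%R -> 0 <= x -> x <= y ->
  x `^ s <= y `^ s.
Proof.
by move=> s0 x0 xy; apply: gt0_ler_poweR; rewrite ?in_itv/= ?x0 ?leey ?(le_trans x0 xy).
Qed.

Lemma poweRK (x : \bar R) (s : R) : (s != 0)%R -> 0 <= x ->
  (x `^ s) `^ s^-1 = x.
Proof. by move=> s0 x0; rewrite -poweRrM divff// poweRe1. Qed.

Lemma poweRVK (x : \bar R) (s : R) : (s != 0)%R -> 0 <= x ->
  (x `^ s^-1) `^ s = x.
Proof. by move=> s0 x0; rewrite -poweRrM mulVf// poweRe1. Qed.

(** Fatou's lemma in the form used to remove truncations and additive errors: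
   rather than converge, the approximations [P n] only have to end up above
   every number smaller than [Phi x], and nothing is assumed from above. *)
Lemma fatou_pow (s : R) (w : R -> R) (wN : nat -> R -> R) (Phi : R -> \bar R)
    (P : nat -> R -> \bar R) (M : \bar R) :
  (0 < s)%R -> nonneg_measurable w -> (forall n, nonneg_measurable (wN n)) ->
  (forall x, exists n, forall m, (n <= m)%N -> wN m x = w x) ->
  emeas Phi -> (forall x, 0 <= Phi x) ->
  (forall n, emeas (P n)) -> (forall n x, 0 <= P n x) ->
  (forall x a, (0 <= a)%R -> a%:E < Phi x ->
     exists n, forall m, (n <= m)%N -> a%:E <= P m x) ->
  (forall n, \int[leb]_x (P n x `^ s * (wN n x)%:E) <= M) ->
  \int[leb]_x (Phi x `^ s * (w x)%:E) <= M.
Proof.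
move=> s0 nw nwN cw mPhi Phi0 mP P0 PhiP PM.
have mI n : emeas (fun x => P n x `^ s * (wN n x)%:E).
  by apply: emeasM; [exact: emeas_pow|exact: emeas_fin].
have I0 n x : 0 <= P n x `^ s * (wN n x)%:E.
  by rewrite mule_ge0 ?poweR_ge0 ?lee_fin ?(nwN n).1.
apply: (@le_trans _ _
    (\int[leb]_x limn_einf (fun n => P n x `^ s * (wN n x)%:E))); last first.
  apply: le_trans (limn_einf_ub PM).
  by apply: (@fatou _ (lebesgueR R)).
apply: le_int => //.
- by apply: emeasM; [exact: emeas_pow|exact: emeas_fin].
- rewrite /limn_einf; apply: (measurableT_comp (@oppe_measurable R setT)).
  apply: measurable_fun_limn_esup => n.
  by apply: (measurableT_comp (@oppe_measurable R setT)); exact: mI.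
- by move=> x _; rewrite mule_ge0 ?poweR_ge0 ?lee_fin ?nw.1.
move=> x _.
set l := limn_einf _.
have l0 : 0 <= l by apply: (@limn_einf_lb _ _ 0) => m _; exact: I0.
have := nw.1 x; rewrite le_eqVlt => /predU1P[<-|wx]; first by rewrite mule0.
have al a : (0 <= a)%R -> a%:E < Phi x -> (a `^ s * w x)%:E <= l.
  move=> a0 /(PhiP _ _ a0)[n1 an]; have [n2 wn] := cw x.
  apply: (@limn_einf_lb _ _ (maxn n1 n2)) => m; rewrite geq_max => /andP[m1 m2].
  rewrite wn// EFinM; apply: lee_wpmul2r; first by rewrite lee_fin ltW.
  by rewrite -poweR_EFin; apply: poweR_le; rewrite ?lee_fin ?an// ltW.
rewrite leNgt; apply/negP => lPhi.
have lfin : l \is a fin_num by rewrite ge0_fin_numE// (lt_le_trans lPhi)// leey.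
move: lPhi al l0; rewrite -(fineK lfin); set r := fine l.
rewrite muleC -lte_pdivrMl// => rPhi al; rewrite lee_fin => r0.
have rw0 : (0 <= (w x)^-1 * r)%R by rewrite mulr_ge0// invr_ge0 ltW.
(* A strict inequality [l < Phi x ^ s * w x] leaves room for a real [a]
   with [l < a ^ s * w x] and [a < Phi x]. *)
have : (((w x)^-1 * r) `^ s^-1)%:E < Phi x.
  rewrite ltNge; apply/negP => /(poweR_le (ltW s0) (Phi0 x)).
  rewrite -poweR_EFin poweRVK ?gt_eqF ?lee_fin// => /(lt_le_trans rPhi).
  by rewrite EFinM ltxx.
move=> bPhi; set b := (_ `^ s^-1)%R in bPhi.
have [a ra aPhi] : exists2 a, (b < a)%R & a%:E < Phi x.
  case: (Phi x) bPhi => [phi| |//]; last by exists (b + 1)%R; rewrite ?ltrDl ?ltry.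
  rewrite lte_fin => bphi; exists ((b + phi) / 2)%R; rewrite ?lte_fin; lra.
have a0 : (0 <= a)%R by rewrite (le_trans _ (ltW ra))// powR_ge0.
have := al _ a0 aPhi; rewrite lee_fin leNgt => /negP; apply.
rewrite -ltr_pdivrMr// mulrC.
have -> : ((w x)^-1 * r = b `^ s)%R.
  by rewrite /b -powRrM mulVf ?gt_eqF// powRr1.
by apply: gt0_ltr_powR => //; rewrite nnegrE// powR_ge0.
Qed.

(** Boundedness and bounded support are controlled by the same [M], which
   serves both as a Lipschitz constant for the primitive and as an endpoint. *)
Definition tame (M : R) f := [/\ nonneg_measurable f,
  (forall x, f x <= M)%R & (forall x, M <= `|x| -> f x = 0)%R].

Section tame.
Variables (M : R) (f : R -> R).
Hypothesis tf : tame M f.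
Let nf : nonneg_measurable f. Proof. by case: tf. Qed.

Lemma tame_ge0 : (0 <= M)%R.
Proof. by case: tf => [[f0 _] fM _]; exact: le_trans (f0 0%R) (fM 0%R). Qed.

Lemma int_tame_oc (x y : R) : (x <= y)%R ->
  \int[leb]_(t in `]x, y]) (f t)%:E <= (M * (y - x))%:E.
Proof.
move=> xy; apply: (@le_trans _ _ (\int[leb]_(t in `]x, y]) (cst M%:E t))).
  apply: le_int => //.
  - exact: emeas_fin.
  - exact: measurable_cst.
  - by move=> t _; rewrite lee_fin nf.1.
  - by move=> t _; rewrite lee_fin; case: tf.
by rewrite integral_cst//= ?leb_oc// ; exact: mset_itv.
Qed.

Lemma prim_tame_low x : (x <= - M)%R -> prim f x = 0.
Proof.
move=> xM; apply: integral0_eq => t /=; rewrite in_itv/= => tx.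
case: tf => _ _ ->//; rewrite ler0_norm; first by rewrite lerNr (le_trans tx).
by rewrite (le_trans tx)// (le_trans xM)// oppr_le0 tame_ge0.
Qed.

Lemma prim_tame_le x y : (x <= y)%R -> prim f y <= prim f x + (M * (y - x))%:E.
Proof.
move=> xy; rewrite /prim (int_itvNyc_split xy) ?leeD2l ?int_tame_oc//.
  exact: emeas_fin.
by move=> t; rewrite lee_fin nf.1.
Qed.

Lemma prim_tame_fin x : prim f x \is a fin_num.
Proof.
have [xM|/ltW xM] := leP x (- M)%R; first by rewrite prim_tame_low.
rewrite ge0_fin_numE ?prim_ge0//; apply: le_lt_trans (prim_tame_le xM) _.
by rewrite prim_tame_low// add0e ltry.
Qed.

Lemma int_tame (y : R) : (M <= y)%R -> \int[leb]_x (f x)%:E = prim f y.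
Proof.
move=> My; have -> : [set: lebesgueR R] = `]-oo, y] `|` `]y, +oo[.
  apply/seteqP; split => x _ //=; rewrite !in_itv/= andbT.
  by case: (leP x y); [left|right].
rewrite int_split//.
- rewrite [X in _ + X]integral0_eq ?adde0// => x /=; rewrite in_itv/= andbT => yx.
  have Mx := le_trans My (ltW yx).
  by case: tf => _ _ ->//; rewrite ger0_norm// (le_trans tame_ge0).
- exact: emeas_fin.
- by move=> t; rewrite lee_fin nf.1.
- by move=> x /=; rewrite !in_itv/= andbT leNgt => /negP.
Qed.

Lemma prim_tame_top y : prim f y <= prim f M.
Proof.
rewrite -(int_tame (lexx M)); apply: le_int_sub => //; first exact: emeas_fin.
by move=> x; rewrite lee_fin nf.1.
Qed.

(** The primitive of a tame function is Lipschitz, so that the intermediate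
   value theorem applies. *)
Lemma prim_level (c : R) : (0 <= c)%R -> c%:E <= prim f M ->
  exists s, prim f s = c%:E.
Proof.
move=> c0 cM; pose F x := fine (prim f x).
have FE x : prim f x = (F x)%:E by rewrite /F fineK// prim_tame_fin.
have M0 := tame_ge0.
have Flip x y : (`|F x - F y| <= M * `|x - y|)%R.
  wlog xy : x y / (x <= y)%R.
    move=> h; have [|/ltW] := leP x y; first exact: h.
    by move/h; rewrite distrC [(`|x - y|)%R]distrC.
  have := prim_tame_le xy; rewrite !FE -EFinD lee_fin => h.
  have := prim_homo nf xy; rewrite !FE lee_fin => h'.
  by rewrite distrC ger0_norm ?subr_ge0// distrC ger0_norm ?subr_ge0// lerBlDl.
have cF : continuous F.
  move=> x; apply/cvgrPdist_lt => e e0.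
  have M1 : (0 < M + 1)%R by rewrite ltr_wpDl.
  near=> y; apply: (le_lt_trans (Flip _ _)).
  apply: (@le_lt_trans _ _ ((M + 1) * `|x - y|)%R); first by rewrite ler_wpM2r// lerDl.
  rewrite mulrC -ltr_pdivlMr//; near: y.
  exact: (nbhs_ball_norm x (PosNum (divr_gt0 e0 M1))).
have NM : (- M <= M)%R by rewrite ge0_cp.
have Flow : F (- M)%R = 0%R by rewrite /F prim_tame_low.
have [|s _ Fs] := @IVT R F _ _ c NM (continuous_subspaceT cF).
  have F0 : (F (- M) <= F M)%R by rewrite -lee_fin -!FE prim_homo.
  by rewrite min_l// max_r// Flow c0 -lee_fin -FE.
by exists s; rewrite FE Fs.
Unshelve. all: by end_near. Qed.

End tame.

Definition trunc (n : nat) f (x : R) : R :=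
  if (`|x| < n%:R)%R && (f x <= n%:R)%R then f x else 0%R.

Lemma trunc_le n f x : nonneg_measurable f -> (trunc n f x <= f x)%R.
Proof. by move=> [f0 _]; rewrite /trunc; case: ifP. Qed.

Lemma trunc_nnm n f : nonneg_measurable f -> nonneg_measurable (trunc n f).
Proof.
move=> [f0 mf]; split; first by move=> x; rewrite /trunc; case: ifP.
pose b (x : lebesgueR R) := (`|x : R| < n%:R)%R && (f x <= n%:R)%R.
suff mb : measurable_fun [set: lebesgueR R] b.
  exact: (measurable_fun_ifT mb mf (measurable_cst (0 : R)%R)).
apply: measurable_and.
  apply: (measurable_fun_bool true); rewrite setTI.
  rewrite (_ : _ @^-1` _ = `](- n%:R)%R, n%:R%R[%classic :> set R); first exact: mset_itv.
  by apply/seteqP; split => x /=; rewrite in_itv/= ltr_norml.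
by apply: measurable_fun_ler => //; exact: measurable_cst.
Qed.

Lemma trunc_tame n f : nonneg_measurable f -> tame n%:R (trunc n f).
Proof.
move=> nf; split; first exact: trunc_nnm.
  by move=> x; rewrite /trunc; case: ifP => // /andP[].
by move=> x; rewrite /trunc ltNge => ->.
Qed.

Lemma trunc_ev f x : exists n, forall m, (n <= m)%N -> trunc m f x = f x.
Proof.
pose n := (Num.truncn `|x| + Num.truncn `|f x|).+1; exists n => m nm.
have h1 : (`|x| < m%:R)%R.
  apply: lt_le_trans (_ : (n%:R <= _)%R); last by rewrite ler_nat.
  apply: lt_le_trans (truncnS_gt _) _; rewrite ler_nat ltnS leq_addr//.
have h2 : (f x <= m%:R)%R.
  apply: le_trans (ler_norm _) (ltW _).
  apply: lt_le_trans (_ : (n%:R <= _)%R); last by rewrite ler_nat.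
  apply: lt_le_trans (truncnS_gt _) _; rewrite ler_nat ltnS leq_addl//.
by rewrite /trunc h1 h2.
Qed.

Lemma trunc_homo f x n m : nonneg_measurable f -> (n <= m)%N ->
  (trunc n f x <= trunc m f x)%R.
Proof.
move=> nf nm; rewrite {1}/trunc; case: ifP => [/andP[h1 h2]|_].
  have nmR : (n%:R <= m%:R :> R)%R by rewrite ler_nat.
  by rewrite /trunc (lt_le_trans h1 nmR) (le_trans h2 nmR).
by case: (trunc_nnm m nf).
Qed.

Lemma trunc_int_lt f (D : set R) (G : R -> \bar R) (a : \bar R) :
  nonneg_measurable f -> mset D -> emeas G -> (forall x, 0 <= G x) ->
  a < \int[leb]_(t in D) (G t * (f t)%:E) ->
  exists n, forall m, (n <= m)%N ->
    a < \int[leb]_(t in D) (G t * (trunc m f t)%:E).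
Proof.
move=> nf mD mG G0 alt.
have mI n : emeas (fun x => G x * (trunc n f x)%:E).
  by apply: emeasM => //; apply: emeas_fin; exact: trunc_nnm.
have I0 n x : 0 <= G x * (trunc n f x)%:E.
  by rewrite mule_ge0 ?lee_fin ?(trunc_nnm n nf).1.
have := @cvg_monotone_convergence _ (lebesgueR R) R leb D mD
  (fun n x => G x * (trunc n f x)%:E) _ _ _.
move=> /(_ (fun n => measurable_funTS (mI n)) (fun n x _ => I0 n x)).
have nd x : D x -> {homo (fun n => G x * (trunc n f x)%:E) : n m / (n <= m)%N >-> n <= m}.
  by move=> _ n m nm; rewrite lee_wpmul2l ?lee_fin ?trunc_homo.
move=> /(_ nd).
have -> : \int[leb]_(x in D) limn (fun n => G x * (trunc n f x)%:E) =
   \int[leb]_(x in D) (G x * (f x)%:E).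
  apply: eq_integral => x _; apply: lim_near_cst => //.
  by have [n nE] := trunc_ev f x; exists n => // m /= /nE ->.
move=> h; have [n _ hn] := h _ (open_nbhs_nbhs (conj (@open_ereal_gt_ereal _ a) alt)).
by exists n => m /hn.
Qed.

(** * Cutting at the levels of a primitive *)
Lemma prim_indic (k a b : R) : (0 <= k)%R -> (a <= b)%R ->
  prim (fun x => k * \1_(`]a, b]) x)%R b = (k * (b - a))%:E.
Proof.
move=> k0 ab; have n1 : nonneg_measurable (\1_(`]a, b]%classic : set R)) by exact: nnm_indic.
rewrite /prim; under eq_integral do rewrite EFinM.
rewrite intZ ?lee_fin//; last exact: (emeas_fin n1).
rewrite integral_indic//=; [|exact: mset_itv..].
rewrite (_ : _ `&` _ = `]a, b]%classic) ?leb_oc//.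
by apply/seteqP; split => x /=; rewrite !in_itv/=; [case|case/andP=> -> ->].
Qed.

Section weight.
Variable om : R -> R.
Hypothesis om0 : (forall x, 0 <= om x)%R.
Hypothesis omn : {homo om : x y / (x <= y)%R >-> (y <= x)%R}.

Lemma nnm_om : nonneg_measurable om.
Proof. exact: nnm_nhomo. Qed.

Lemma emeas_om f : nonneg_measurable f -> emeas (fun x => (f x * om x)%:E).
Proof. by move=> nf; apply: emeas_fin; apply: nnmM => //; exact: nnm_om. Qed.

Lemma int_om_ge f (a b : R) : nonneg_measurable f ->
  (om b)%:E * \int[leb]_(t in `]a, b]) (f t)%:E <=
  \int[leb]_(t in `]a, b]) (f t * om t)%:E.
Proof.
move=> nf; rewrite -intZ//; last 3 first.
- exact: emeas_fin.
- by move=> x; rewrite lee_fin nf.1.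
- by rewrite lee_fin.
apply: le_int => //.
- by apply: emeasM; [exact: measurable_cst|exact: emeas_fin].
- exact: emeas_om.
- by move=> x _; rewrite -EFinM lee_fin mulr_ge0 ?nf.1.
- move=> x /=; rewrite in_itv/= => /andP[_ xb].
  by rewrite -EFinM lee_fin mulrC ler_wpM2l ?nf.1 ?omn.
Qed.

Lemma int_om_oc_le (k a b : R) : (0 <= k)%R -> (a <= b)%R ->
  \int[leb]_x (k * \1_(`]a, b]) x * om x)%:E <= (k * (b - a) * om a)%:E.
Proof.
move=> k0 ab.
have n1 : nonneg_measurable (\1_(`]a, b]%classic : set R)) by exact: nnm_indic.
apply: (@le_trans _ _ (\int[leb]_x ((k * om a)%:E * (\1_(`]a, b]%classic : set R) x)%:E))).
  apply: le_int => //.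
  - by apply: emeas_om; apply: nnmM => //; exact: nnm_cst.
  - by apply: emeasM; [exact: measurable_cst|exact: emeas_fin].
  - by move=> x _; rewrite lee_fin !mulr_ge0// indicE.
  - move=> x _; rewrite -EFinM lee_fin indicE.
    have [/set_mem /=|_] := boolP (x \in (`]a, b]%classic : set R)); last first.
      by rewrite !mulr0 mul0r.
    rewrite in_itv/= => /andP[ax _].
    by rewrite !mulr1 ler_wpM2l// omn// ltW.
rewrite intZ//; last 2 first.
- exact: (emeas_fin n1).
- by rewrite lee_fin mulr_ge0.
rewrite integral_indic//=; last exact: mset_itv.
by rewrite setIT leb_oc// -EFinM lee_fin mulrAC.
Qed.

Lemma le_int_om f (D : set R) : nonneg_measurable f -> mset D ->
  \int[leb]_(t in D) (f t * om t)%:E <= \int[leb]_t (f t * om t)%:E.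
Proof.
move=> nf mD; apply: le_int_sub => //; first exact: emeas_om.
by move=> x; rewrite lee_fin mulr_ge0// nf.1.
Qed.

End weight.

Section duality.
Variables (p : R) (v om : R -> R).
Hypothesis p1 : (1 <= p)%R.
Hypothesis nv : nonneg_measurable v.
Hypothesis om0 : (forall x, 0 <= om x)%R.
Hypothesis omn : {homo om : x y / (x <= y)%R >-> (y <= x)%R}.

(** The two halves of the duality between the [p]-th power price with weight
   [v] and the nonincreasing weight [om]: [om b] is the infimum of the
   prices of a unit of mass placed to the left of [b]. *)
Definition hoelder_bound := forall f (a b m : R), nonneg_measurable f ->
  \int[leb]_(t in `]a, b]) (f t)%:E = m%:E ->
  (m `^ p * om b)%:E <= \int[leb]_(t in `]a, b]) (f t `^ p * v t)%:E.

Definition hoelder_sharp := forall s m e : R, (0 <= m)%R -> (0 < e)%R ->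
  exists g, [/\ nonneg_measurable g, prim g s = m%:E &
    \int[leb]_t (g t `^ p * v t)%:E <= (m `^ p * om s + e)%:E].

Let p0 : (0 < p)%R. Proof. exact: lt_le_trans p1. Qed.

Lemma emeas_pv f : nonneg_measurable f -> emeas (fun t => (f t `^ p * v t)%:E).
Proof. by move=> nf; exact: (emeas_fin (nnmM (nnm_pow p nf) nv)). Qed.

Lemma pv_ge0 f x : (0 <= (f x `^ p * v x)%:E).
Proof. by rewrite lee_fin mulr_ge0 ?powR_ge0 ?nv.1. Qed.

Lemma int_zero_pv : \int[leb]_t (((fun _ : R => 0%R) t) `^ p * v t)%:E = 0.
Proof. by apply: integral0_eq => x _; rewrite powR0 ?gt_eqF// mul0r. Qed.

Lemma level_lt M f (s t a b : R) : tame M f -> prim f s = a%:E -> prim f t = b%:E ->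
  (a < b)%R -> (s < t)%R.
Proof.
move=> [nf _ _] fs ft ab; rewrite ltNge; apply/negP => /(prim_homo nf).
by rewrite fs ft lee_fin leNgt ab.
Qed.

Lemma int_level M f (s t a b : R) : tame M f -> prim f s = a%:E -> prim f t = b%:E ->
  (a < b)%R -> \int[leb]_(x in `]s, t]) (f x)%:E = (b - a)%:E.
Proof.
move=> tf fs ft ab; have st := level_lt tf fs ft ab; have [nf _ _] := tf.
have := ft; rewrite /prim (int_itvNyc_split (ltW st)); last 2 first.
- exact: emeas_fin.
- by move=> x; rewrite lee_fin nf.1.
rewrite -/(prim f s) fs => h.
by rewrite EFinB -h addeAC subee ?add0e.
Qed.

(** Induction on the number of levels below [s].  The maximum of two functions
   is priced at most the sum of the two prices, and its primitive dominates
   both primitives; a sum would instead cost a factor [2 ^ (p - 1)] at each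
   step.  The price of the new function is charged to the interval between two
   consecutive levels, hence the integral up to [s] in the last bound. *)
Lemma pow_primitive_step M f eta (m : nat) : hoelder_sharp -> tame M f -> (0 < eta)%R ->
  forall s e, prim f s = (eta * 2 ^+ m)%:E -> (0 < e)%R -> exists g,
  [/\ nonneg_measurable g,
     (forall y, prim f y <= (eta * 2 ^+ m.+1)%:E ->
        prim f y <= 2%:E * prim g y `^ p + (2 * eta)%:E) &
     \int[leb]_t (g t `^ p * v t)%:E <=
       2%:E * \int[leb]_(t in `]-oo, s]) (f t * om t)%:E + e%:E].
Proof.
move=> H2 tf eta0; have [nf _ _] := tf; elim: m => [|m IH] s e fs e0.
  exists (fun=> 0%R); split; first exact: nnm_cst.
    move=> y; rewrite expr1 mulrC => /le_trans; apply.
    by rewrite leeDr// mule_ge0 ?poweR_ge0.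
  rewrite int_zero_pv adde_ge0 ?lee_fin ?(ltW e0)// mule_ge0//.
  by apply: integral_ge0 => x _; rewrite lee_fin mulr_ge0 ?nf.1.
have lt_lev : (eta * 2 ^+ m < eta * 2 ^+ m.+1)%R.
  by rewrite ltr_pM2l// ltr_eXn2l// ltr1n.
have [s' fs'] : exists s', prim f s' = (eta * 2 ^+ m)%:E.
  apply: (prim_level tf); first by rewrite mulr_ge0 ?exprn_ge0// ltW.
  by apply: le_trans (prim_tame_top tf s); rewrite fs lee_fin ltW.
have ss' := level_lt tf fs' fs lt_lev.
have e2 : (0 < e / 2)%R by rewrite divr_gt0.
have [g1 [ng1 cov1 cost1]] := IH s' _ fs' e2.
set l := (eta * 2 ^+ m.+1)%R in fs lt_lev *.
have l0 : (0 <= l)%R by rewrite mulr_ge0 ?exprn_ge0// ltW.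
(* A mass [l ^ (1 / p)] to the left of [s] makes [prim g ^ p] at least [l] on
   the next stretch, where [prim f] is at most [2 * l]. *)
have [g2 [ng2 mass2 cost2]] := H2 s _ _ (powR_ge0 l p^-1) e2.
have lpK : ((l `^ p^-1) `^ p = l)%R by rewrite -powRrM mulVf ?gt_eqF// powRr1.
rewrite lpK in cost2.
have nmax := nnm_max ng1 ng2.
exists (fun x => Num.max (g1 x) (g2 x)); split => //.
- move=> y fy; have [ly|ly] := leP (prim f y) l%:E.
    apply: le_trans (cov1 _ ly) _; rewrite leeD2r// lee_wpmul2l//.
    apply: poweR_le; rewrite ?prim_ge0 ?(ltW p0)//.
    by apply: le_prim => // x; rewrite le_max lexx.
  have sy : (s < y)%R.
    by rewrite ltNge; apply/negP => /(prim_homo nf); rewrite fs leNgt ly.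
  apply: le_trans fy _; rewrite exprS mulrCA -/l EFinM.
  apply: (@le_trans _ _ (2%:E * prim (fun x => Num.max (g1 x) (g2 x)) y `^ p)).
    rewrite lee_wpmul2l// -[in leLHS]lpK -poweR_EFin.
    apply: poweR_le; rewrite ?lee_fin ?powR_ge0 ?(ltW p0)//.
    rewrite -mass2; apply: le_trans (prim_homo ng2 (ltW sy)) _.
    by apply: le_prim => // x; rewrite le_max lexx orbT.
  by rewrite leeDl// lee_fin mulr_ge0// ltW.
apply: (@le_trans _ _ (\int[leb]_t ((g1 t `^ p * v t)%:E + (g2 t `^ p * v t)%:E))).
  apply: le_int => //.
  - exact: emeas_pv.
  - by apply: emeasD; exact: emeas_pv.
  - by move=> x _; exact: (pv_ge0 (fun x => Num.max (g1 x) (g2 x))).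
  - move=> x _; rewrite -EFinD lee_fin -mulrDl ler_wpM2r ?nv.1//.
    by rewrite /Num.max; case: ifP => _; rewrite ?lerDr ?lerDl powR_ge0.
rewrite intD//; last 4 first.
- exact: emeas_pv.
- exact: emeas_pv.
- exact: pv_ge0.
- exact: pv_ge0.
rewrite (mule_int_itvNyc_split _ (ltW ss')); last 2 first.
- exact: emeas_om.
- by move=> x; rewrite lee_fin mulr_ge0 ?nf.1.
apply: le_trans (leeD cost1 cost2) _.
(* Between [s'] and [s] the function [f] has mass [l / 2], at places where
   [om] is at least [om s]. *)
have := int_om_ge om0 omn s' s nf; rewrite (int_level tf fs' fs lt_lev).
have -> : (l - eta * 2 ^+ m = l / 2)%R by rewrite /l exprS; field.
move=> h.
have h2 : (l * om s)%:E <= 2%:E * \int[leb]_(t in `]s', s]) (f t * om t)%:E.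
  apply: le_trans (lee_wpmul2l _ h) => //; rewrite -!EFinM lee_fin.
  by rewrite [leRHS](_ : _ = (l * om s)%R)//; field.
rewrite [(l * om s + _)%:E]EFinD addeACA -EFinD -splitr.
by apply: leeD2r; exact: leeD2l.
Qed.

(** The level [eta * 2 ^ m] reached last is within a factor two of the total
   mass of [f]; below the first level the error [2 * eta] takes over. *)
Lemma pow_primitive M f eta e : hoelder_sharp -> tame M f -> (0 < eta)%R -> (0 < e)%R ->
  exists g, [/\ nonneg_measurable g,
     (forall y, prim f y <= 2%:E * prim g y `^ p + (2 * eta)%:E) &
     \int[leb]_t (g t `^ p * v t)%:E <=
       2%:E * \int[leb]_t (f t * om t)%:E + e%:E].
Proof.
move=> H2 tf eta0 e0; have [nf _ _] := tf.
have [fM|fM] := leP (prim f M) (2 * eta)%:E.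
  exists (fun=> 0%R); split; first exact: nnm_cst.
    move=> y; apply: le_trans (prim_tame_top tf y) (le_trans fM _).
    by rewrite leeDr// mule_ge0 ?poweR_ge0.
  rewrite int_zero_pv adde_ge0 ?lee_fin ?(ltW e0)// mule_ge0//.
  by apply: integral_ge0 => x _; rewrite lee_fin mulr_ge0 ?nf.1.
have [m [m1 m2]] : exists m : nat, (eta * 2 ^+ m)%:E <= prim f M /\
    prim f M <= (eta * 2 ^+ m.+1)%:E.
  have := prim_tame_fin tf M => /fineK; set F := fine _ => FE.
  rewrite -FE lte_fin in fM *.
  have [k Fk] : exists k : nat, (F <= eta * 2 ^+ k)%R.
    exists (Num.truncn (F / eta)).+1; rewrite mulrC -ler_pdivrMr//.
    apply: ltW (lt_le_trans (truncnS_gt _) _).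
    by rewrite -natrX ler_nat ltnW// ltn_expl.
  elim: k Fk => [|k IH] Fk.
    by exists 0%N; rewrite expr0 mulr1 expr1 !lee_fin; split; lra.
  have [/IH//|kF] := leP F (eta * 2 ^+ k)%R.
  by exists k; rewrite !lee_fin Fk ltW.
have [s fs] : exists s, prim f s = (eta * 2 ^+ m)%:E.
  by apply: (prim_level tf) => //; rewrite mulr_ge0 ?exprn_ge0// ltW.
have [g [ng cov cost]] := pow_primitive_step H2 tf eta0 fs e0.
exists g; split => //.
  by move=> y; apply: cov; apply: le_trans (prim_tame_top tf y) m2.
apply: le_trans cost _; rewrite leeD2r// lee_wpmul2l//.
exact: le_int_om.
Qed.

(** Converse construction.  The mass replacing the level of [s] has to be
   placed to the right of [s], where [om] is at most [om s]; it is spread over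
   [`]s, u]], with [u] the next level point in the induction, and therefore
   counts only from [u] on.  This delay of one level is the reason for the bound up to
   [2 ^ (m + 2)] and for the factor [4]. *)
Lemma primitive_pow_step M f eta (m : nat) : hoelder_bound -> tame M f -> (0 < eta)%R ->
  forall s u, prim f s = (eta * 2 ^+ m)%:E -> (s < u)%R -> exists h,
  [/\ nonneg_measurable h,
     (forall y, (u <= y)%R \/ prim f y <= (eta * 2 ^+ m.+1)%:E ->
        prim f y <= (eta * 2 ^+ m.+2)%:E ->
        prim f y `^ p <= (4 `^ p)%:E * prim h y + ((4 * eta) `^ p)%:E) &
     \int[leb]_t (h t * om t)%:E <=
       (2 `^ p)%:E * \int[leb]_(t in `]-oo, s]) (f t `^ p * v t)%:E].
Proof.
move=> H1 tf eta0; have [nf _ _] := tf; elim: m => [|m IH] s u fs su.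
  exists (fun=> 0%R); split; first exact: nnm_cst.
    move=> y _ fy; apply: (@le_trans _ _ ((4 * eta) `^ p)%:E); last first.
      by rewrite leeDr// mule_ge0 ?lee_fin ?powR_ge0 ?prim_ge0//; exact: nnm_cst.
    rewrite -poweR_EFin; apply: poweR_le; rewrite ?(ltW p0) ?prim_ge0//.
    by apply: le_trans fy _; rewrite lee_fin; lra.
  rewrite integral0_eq => [|x _]; last by rewrite mul0r.
  by rewrite mule_ge0 ?lee_fin ?powR_ge0//; apply: integral_ge0 => x _; exact: pv_ge0.
have lt_lev : (eta * 2 ^+ m < eta * 2 ^+ m.+1)%R.
  by rewrite ltr_pM2l// ltr_eXn2l// ltr1n.
have [s' fs'] : exists s', prim f s' = (eta * 2 ^+ m)%:E.
  apply: (prim_level tf); first by rewrite mulr_ge0 ?exprn_ge0// ltW.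
  by apply: le_trans (prim_tame_top tf s); rewrite fs lee_fin ltW.
have ss' := level_lt tf fs' fs lt_lev.
have [h1 [nh1 cov1 cost1]] := IH s' s fs' ss'.
set l := (eta * 2 ^+ m.+1)%R in fs lt_lev cov1 *.
have l0 : (0 <= l)%R by rewrite mulr_ge0 ?exprn_ge0// ltW.
have us0 : (0 < u - s)%R by rewrite subr_gt0.
pose k := (l `^ p / (u - s))%R.
have k0 : (0 <= k)%R by rewrite divr_ge0 ?powR_ge0// ltW.
pose h2 (x : R) := (k * \1_(`]s, u]%classic : set R) x)%R.
have nh2 : nonneg_measurable h2.
  by apply: nnmM; [exact: nnm_cst|exact: nnm_indic].
have mass2 : prim h2 u = (l `^ p)%:E.
  by rewrite prim_indic ?(ltW su)// /k divfK// gt_eqF.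
have cost2 : \int[leb]_t (h2 t * om t)%:E <= (l `^ p * om s)%:E.
  apply: le_trans (int_om_oc_le om0 omn k0 (ltW su)) _.
  by rewrite /k divfK// gt_eqF.
have nh := nnmD nh1 nh2.
exists (fun x => h1 x + h2 x)%R; split => //.
- move=> y uy fy.
  have [ly|ly] := leP (prim f y) (eta * 2 ^+ m.+2)%:E.
    have sy : (s <= y)%R \/ prim f y <= l%:E.
      have [|/ltW ys] := leP s y; [by left|right].
      by rewrite -fs; exact: prim_homo.
    apply: le_trans (cov1 y sy ly) _; rewrite leeD2r// lee_wpmul2l ?lee_fin ?powR_ge0//.
    by apply: le_prim => // x; rewrite lerDl nh2.1.
  case: uy => [uy|]; last by rewrite leNgt ly.
  apply: (@le_trans _ _ ((4 `^ p)%:E * prim (fun x => h1 x + h2 x)%R y)); last first.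
    by rewrite leeDl// lee_fin powR_ge0.
  apply: (@le_trans _ _ ((4 * l) `^ p)%:E).
    rewrite -poweR_EFin; apply: poweR_le; rewrite ?(ltW p0) ?prim_ge0//.
    by apply: le_trans fy _; rewrite lee_fin /l !exprS; lra.
  rewrite powRM// EFinM lee_wpmul2l ?lee_fin ?powR_ge0// -mass2.
  apply: le_trans (prim_homo nh2 uy) _.
  by apply: le_prim => // x; rewrite lerDr nh1.1.
under eq_integral do rewrite mulrDl EFinD.
rewrite intD//; last 4 first.
- exact: emeas_om.
- exact: emeas_om.
- by move=> x; rewrite lee_fin mulr_ge0 ?nh1.1.
- by move=> x; rewrite lee_fin mulr_ge0 ?nh2.1.
rewrite (mule_int_itvNyc_split _ (ltW ss')); last 2 first.
- exact: emeas_pv.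
- exact: pv_ge0.
apply: leeD cost1 (le_trans cost2 _).
(* The mass [l / 2] of [f] on the interval already costs at least
   [(l / 2) ^ p * om s]. *)
have := H1 f s' s _ nf (int_level tf fs' fs lt_lev).
have -> : (l - eta * 2 ^+ m = l / 2)%R by rewrite /l exprS; field.
have c0 : 0 <= (2 `^ p)%:E :> \bar R by rewrite lee_fin powR_ge0.
move=> /(lee_wpmul2l c0)/(le_trans _); apply.
by rewrite -EFinM lee_fin mulrA -powRM ?divr_ge0// [(2 * _)%R]mulrC divfK.
Qed.

Lemma primitive_pow M f eta : hoelder_bound -> tame M f -> (0 < eta)%R ->
  exists h, [/\ nonneg_measurable h,
     (forall y, prim f y `^ p <= (4 `^ p)%:E * prim h y + ((4 * eta) `^ p)%:E) &
     \int[leb]_t (h t * om t)%:E <=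
       (2 `^ p)%:E * \int[leb]_t (f t `^ p * v t)%:E].
Proof.
move=> H1 tf eta0; have [nf _ _] := tf.
have [fM|fM] := leP (prim f M) (4 * eta)%:E.
  exists (fun=> 0%R); split; first exact: nnm_cst.
    move=> y; apply: (@le_trans _ _ ((4 * eta) `^ p)%:E); last first.
      by rewrite leeDr// mule_ge0 ?lee_fin ?powR_ge0 ?prim_ge0//; exact: nnm_cst.
    rewrite -poweR_EFin; apply: poweR_le; rewrite ?(ltW p0) ?prim_ge0//.
    exact: le_trans (prim_tame_top tf y) fM.
  rewrite integral0_eq => [|x _]; last by rewrite mul0r.
  by rewrite mule_ge0 ?lee_fin ?powR_ge0//; apply: integral_ge0 => x _; exact: pv_ge0.
have [m [m1 m2]] : exists m : nat, (eta * 2 ^+ m.+1)%:E <= prim f M /\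
    prim f M <= (eta * 2 ^+ m.+2)%:E.
  have := prim_tame_fin tf M => /fineK; set F := fine _ => FE.
  rewrite -FE lte_fin in fM *.
  have [k Fk] : exists k : nat, (F <= eta * 2 ^+ k.+1)%R.
    exists (Num.truncn (F / eta)); rewrite mulrC -ler_pdivrMr//.
    apply: ltW (lt_le_trans (truncnS_gt _) _).
    by rewrite -natrX ler_nat ltnW// ltn_expl.
  elim: k Fk => [|k IH] Fk.
    by move: Fk; rewrite expr1 => Fk; exists 0%N; rewrite !lee_fin; split; lra.
  have [/IH//|kF] := leP F (eta * 2 ^+ k.+1)%R.
  by exists k; rewrite !lee_fin Fk ltW.
have lt_lev : (eta * 2 ^+ m < eta * 2 ^+ m.+1)%R.
  by rewrite ltr_pM2l// ltr_eXn2l// ltr1n.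
have lev k : (0 <= eta * 2 ^+ k)%R by rewrite mulr_ge0 ?exprn_ge0// ltW.
have [u fu] := prim_level tf (lev _) m1.
have [|s fs] := prim_level tf (lev m).
  by apply: le_trans m1; rewrite lee_fin ltW.
have su := level_lt tf fs fu lt_lev.
have [h [nh cov cost]] := primitive_pow_step H1 tf eta0 fs su.
exists h; split => //.
  move=> y; apply: cov; last exact: le_trans (prim_tame_top tf y) m2.
  have [|/ltW yu] := leP u y; [by left|right].
  by rewrite -fu; exact: prim_homo.
apply: le_trans cost _; rewrite lee_wpmul2l ?lee_fin ?powR_ge0//.
by apply: le_int_sub => //; [exact: emeas_pv|exact: pv_ge0].
Qed.

End duality.

(** * Concentrating mass *)
(** A nonincreasing function is right continuous outside a countable set: a
   point with a jump to its right is labelled by a rational in the gap, and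
   distinct points get distinct labels.  The upper limit [b] of the points [t]
   is itself exceptional. *)
Lemma right_limit_ae (K : R -> R) (b : R) :
  {homo K : x y / (x <= y)%R >-> (y <= x)%R} ->
  exists N : set R, [/\ mset N, leb N = 0 & forall s e : R, (s <= b)%R -> ~ N s ->
    (0 < e)%R -> exists2 t, (s < t <= b)%R & (K s < K t + e)%R].
Proof.
move=> K1.
pose J (q : rat) := [set s | (ratr q < K s)%R /\
  (forall t, (s < t <= b)%R -> (K t < ratr q)%R)] `&` [set s : R | (s < b)%R].
pose N := (\bigcup_(q in [set: rat]) J q) `|` [set b].
have cN : countable N.
  have -> : N = \bigcup_(i in [set: option rat]) (if i is Some q then J q else [set b]).
    apply/seteqP; split => x [].
    - by case=> q _ Jq; exists (Some q).
    - by move=> xb; exists None.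
    - by move=> [q|] _; [left; exists q|right].
  apply: bigcup_countable => // -[q _|_]; last exact: countable1.
  apply: finite_set_countable.
  have [->|/set0P[s Js]] := eqVneq (J q) set0; first exact: finite_set0.
  apply: (@sub_finite_set _ _ [set s]) => // t Jt /=.
  have aux x y : J q x -> J q y -> ~ (x < y)%R.
    move=> [[_ Kx] _] [[qy _] yb] xy; have := Kx y; rewrite xy (ltW yb).
    by move=> /(_ isT); rewrite ltNge (ltW qy).
  by apply/eqP; rewrite eq_le !leNgt; apply/andP; split; apply/negP; exact: aux.
exists N; split.
- by apply: mset_borel; apply: countable_measurable => // t; exact: measurable_set1.
- exact: countable_lebesgue_measure0.
move=> s e sb Ns e0.
have {}sb : (s < b)%R.
  by rewrite lt_neqAle sb andbT; apply/eqP => sb'; apply: Ns; right.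
have eK : (K s - e < K s)%R by rewrite ltrBlDr ltrDl.
have [q] := rat_in_itvoo eK; rewrite in_itv/= => /andP[q1 q2].
have [h|h] := pselect (exists2 t, (s < t <= b)%R & (K s < K t + e)%R) => //.
exfalso; apply: Ns; left; exists q => //; split => //; split=> // t st.
apply: le_lt_trans q1; rewrite lerBrDr leNgt; apply/negP => Kt.
by apply: h; exists t.
Qed.

Section concentrate_mass.
Variables (K om : R -> R).
Hypothesis K0 : (forall x, 0 <= K x)%R.
Hypothesis K1 : {homo K : x y / (x <= y)%R >-> (y <= x)%R}.
Hypothesis om0 : (forall x, 0 <= om x)%R.
Hypothesis omn : {homo om : x y / (x <= y)%R >-> (y <= x)%R}.

Lemma int_oc_fin (k : R -> R) M f (a b : R) : (forall x, 0 <= k x)%R ->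
  {homo k : x y / (x <= y)%R >-> (y <= x)%R} -> tame M f -> (a <= b)%R ->
  \int[leb]_(y in `]a, b]) (f y * k y)%:E \is a fin_num.
Proof.
move=> k0 kn tf ab; have [nf _ _] := tf.
rewrite ge0_fin_numE; last first.
  by apply: integral_ge0 => x _; rewrite lee_fin mulr_ge0 ?nf.1.
apply: (@le_lt_trans _ _ ((k a)%:E * (M * (b - a))%:E)); last by rewrite -EFinM ltry.
apply: le_trans (lee_wpmul2l _ (int_tame_oc tf ab)); last by rewrite lee_fin.
rewrite -intZ//; last 3 first.
- exact: emeas_fin.
- by move=> x; rewrite lee_fin nf.1.
- by rewrite lee_fin.
apply: le_int => //.
- exact: emeas_om.
- by apply: emeasM; [exact: measurable_cst|exact: emeas_fin].
- by move=> x _; rewrite lee_fin mulr_ge0 ?nf.1.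
move=> x /=; rewrite in_itv/= => /andP[ax _].
by rewrite -EFinM lee_fin mulrC ler_wpM2r ?nf.1 ?kn// ltW.
Qed.

(** Averaging: if no place were good enough, that is if
   [K t * (q + e) < p * om s] whenever [s < t] and [K t] is positive, where [p]
   and [q] are the integrals of [f * K] and [f * om], then letting [t] decrease
   to [s] and integrating against [f] would give [p * (q + e) <= p * q].  The
   mass is placed on [`]s, t]] and not at a point, which is why the price is
   taken at [s] and the gain at [t]. *)
Lemma concentrate_mass M f (a b e : R) : tame M f -> (a < b)%R -> (0 < e)%R ->
  exists g t, [/\ nonneg_measurable g, (t <= b)%R,
    \int[leb]_(y in `]a, b]) (f y * K y)%:E <= (K t)%:E * prim g t &
    \int[leb]_y (g y * om y)%:E <= \int[leb]_(y in `]a, b]) (f y * om y)%:E + e%:E].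
Proof.
move=> tf ab e0; have [nf _ _] := tf.
set P := \int[leb]_(y in `]a, b]) (f y * K y)%:E.
set Q := \int[leb]_(y in `]a, b]) (f y * om y)%:E.
have := int_oc_fin K0 K1 tf (ltW ab); rewrite -/P => /fineK PE.
have := int_oc_fin om0 omn tf (ltW ab); rewrite -/Q => /fineK QE.
have P0 : 0 <= P by apply: integral_ge0 => x _; rewrite lee_fin mulr_ge0 ?nf.1.
have Q0 : 0 <= Q by apply: integral_ge0 => x _; rewrite lee_fin mulr_ge0 ?nf.1.
move: PE QE P0 Q0; set p := fine P; set q := fine Q => PE QE.
rewrite -PE -QE !lee_fin le_eqVlt => /predU1P[p0|p0] q0.
  exists (fun=> 0%R), b; split; [exact: nnm_cst|exact: lexx| |].
    by rewrite -p0 mule_ge0 ?lee_fin ?prim_ge0//; exact: nnm_cst.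
  by rewrite integral0_eq ?adde_ge0 ?lee_fin ?(ltW e0)// => x _; rewrite mul0r.
have [[s [t [a_s st tb Kt]]]|nst] := pselect (exists s t : R,
    [/\ (a <= s)%R, (s < t)%R, (t <= b)%R & (0 < K t)%R /\ (p * om s <= K t * (q + e))%R]).
  case: Kt => Kt pKt.
  have ts0 : (0 < t - s)%R by rewrite subr_gt0.
  (* The mass [p / K t] is the one for which the gain is exactly [p]. *)
  pose k := (p / K t / (t - s))%R.
  have k0 : (0 <= k)%R by rewrite !divr_ge0// ltW.
  exists (fun x => k * \1_(`]s, t]%classic : set R) x)%R, t; split.
  - by apply: nnmM; [exact: nnm_cst|exact: nnm_indic].
  - exact: tb.
  - rewrite prim_indic ?(ltW st)// -EFinM lee_fin /k divfK ?gt_eqF//.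
    by rewrite mulrC divfK// gt_eqF.
  - apply: le_trans (int_om_oc_le om0 omn k0 (ltW st)) _.
    rewrite -EFinD lee_fin /k divfK ?gt_eqF//.
    by rewrite mulrAC ler_pdivrMr// [leRHS]mulrC.
exfalso.
have [N [mN N0 rN]] := right_limit_ae b K1.
have Kom s : (a < s <= b)%R -> ~ N s -> (K s * (q + e) <= p * om s)%R.
  move=> /andP[a_s sb] Ns; have qe0 : (0 < q + e)%R by rewrite ltr_wpDl.
  have := K0 s; rewrite le_eqVlt => /predU1P[<-|Ks0].
    by rewrite mul0r mulr_ge0// ltW.
  rewrite -ler_pdivlMr//; apply/ler_addgt0Pr => d d0.
  have [|t /andP[st tb] Kt] := rN s (Num.min d (K s)) sb Ns; first by rewrite lt_min d0.
  have Kt0 : (0 < K t)%R.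
    have : (K s < K t + K s)%R by apply: lt_le_trans Kt _; rewrite lerD2l ge_min lexx orbT.
    by rewrite ltrDr.
  have Kd : (K s < K t + d)%R by apply: lt_le_trans Kt _; rewrite lerD2l ge_min lexx.
  apply: le_trans (ltW Kd) _; rewrite lerD2r ler_pdivlMr// leNgt; apply/negP => h.
  by apply: nst; exists s, t; split; rewrite ?(ltW a_s)//; split => //; exact: ltW.
have : \int[leb]_(y in `]a, b]) ((q + e)%:E * (f y * K y)%:E) <=
       \int[leb]_(y in `]a, b]) (p%:E * (f y * om y)%:E).
  have qe0 : (0 <= q + e)%R by rewrite addr_ge0// ltW.
  apply: ae_ge0_le_integral.
  - exact: mset_itv.
  - by move=> x _; rewrite -EFinM lee_fin !mulr_ge0 ?nf.1.
  - apply: measurable_funTS; apply: emeasM; [exact: measurable_cst|exact: (emeas_om K0 K1)].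
  - by move=> x _; rewrite -EFinM lee_fin !mulr_ge0 ?nf.1 ?(ltW p0).
  - apply: measurable_funTS; apply: emeasM; [exact: measurable_cst|exact: (emeas_om om0 omn)].
  exists N; split => // y /= nxy; apply: contrapT => Ny; apply: nxy => /=.
  rewrite in_itv/= => yab; rewrite -!EFinM lee_fin mulrCA [leRHS]mulrCA.
  by rewrite ler_wpM2l ?nf.1// mulrC; exact: Kom.
rewrite !intZ//; last 6 first.
- exact: (emeas_om om0 omn).
- by move=> x; rewrite lee_fin mulr_ge0 ?nf.1.
- by rewrite lee_fin ltW.
- exact: (emeas_om K0 K1).
- by move=> x; rewrite lee_fin mulr_ge0 ?nf.1.
- by rewrite lee_fin addr_ge0// ltW.
rewrite -/P -/Q -PE -QE -!EFinM lee_fin leNgt => /negP; apply.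
by rewrite mulrC ltr_pM2r// ltrDl.
Qed.

End concentrate_mass.

(** * From the supremum operator to the integral operator *)
(** The ratio of consecutive tails of [w].  The factor [3 * max c 1] comes
   from a bound of the form [max c 1 * (A + 2 * t)], the power [r] from the
   integrand, and the leading [2] from the two terms that one step of the
   induction has to pay for. *)
Definition disc_base (c r : R) : R := (2 * (3 * Num.max c 1) `^ r)%R.

Section kernel_operator.
Variables (K : R -> R -> R) (c : R).
Hypothesis K0 : (forall y x, 0 <= K y x)%R.
Hypothesis K1 : (forall x y1 y2, y1 <= y2 -> K y2 x <= K y1 x)%R.
Hypothesis K2 : (forall y x1 x2, x1 <= x2 -> K y x1 <= K y x2)%R.
Hypothesis Kreg : (forall x y z, x <= y -> y <= z -> K x z <= c * (K x y + K y z))%R.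

Definition kop f (x : R) : \bar R := \int[leb]_(y in `]-oo, x]) (K y x * f y)%:E.

Lemma nnm_Kf f x : nonneg_measurable f -> nonneg_measurable (fun y => K y x * f y)%R.
Proof. by move=> nf; apply: (nnmM _ nf); apply: nnm_nhomo => [y|y1 y2]; [exact: K0|exact: K1]. Qed.

Lemma kop_ge0 f x : nonneg_measurable f -> 0 <= kop f x.
Proof. by move=> nf; apply: integral_ge0 => y _; rewrite lee_fin mulr_ge0 ?nf.1. Qed.

Lemma kop_homo f : nonneg_measurable f ->
  {homo kop f : x y / (x <= y)%R >-> x <= y}.
Proof.
move=> nf x x' xx'.
apply: (@le_trans _ _ (\int[leb]_(y in `]-oo, x]) (K y x' * f y)%:E)).
  apply: le_int => //.
  - exact/emeas_fin/nnm_Kf.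
  - exact/emeas_fin/nnm_Kf.
  - by move=> y _; rewrite lee_fin mulr_ge0 ?nf.1.
  - by move=> y _; rewrite lee_fin ler_wpM2r ?nf.1 ?K2.
apply: le_int_sub => //.
- exact/emeas_fin/nnm_Kf.
- by move=> y; rewrite lee_fin mulr_ge0 ?nf.1.
- by move=> y /=; rewrite !in_itv/= => /le_trans->.
Qed.

Lemma kop_fin M f x : tame M f -> kop f x \is a fin_num.
Proof.
move=> tf; have [nf _ f0] := tf; rewrite ge0_fin_numE ?kop_ge0//.
apply: (@le_lt_trans _ _ ((K (- M) x)%:E * prim f x)); last first.
  by rewrite -(fineK (prim_tame_fin tf x)) -EFinM ltry.
rewrite -intZ ?lee_fin//; last 2 first.
- exact: emeas_fin.
- by move=> y; rewrite lee_fin nf.1.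
apply: le_int => //.
- exact/emeas_fin/nnm_Kf.
- by apply: emeasM; [exact: measurable_cst|exact: emeas_fin].
- by move=> y _; rewrite lee_fin mulr_ge0 ?nf.1.
move=> y _; rewrite -EFinM lee_fin.
have [yM|/ltW My] := leP y (- M)%R; last by rewrite ler_wpM2r ?nf.1 ?K1.
rewrite f0 ?mulr0// ler0_norm; first by rewrite lerNr.
by rewrite (le_trans yM)// oppr_le0; exact: tame_ge0 tf.
Qed.

Lemma kop_tame_low M f x : tame M f -> (x <= - M)%R -> kop f x = 0.
Proof.
move=> tf xM; apply: integral0_eq => y /=; rewrite in_itv/= => yx.
have [_ _ ->] := tf; rewrite ?mulr0// ler0_norm; first by rewrite lerNr (le_trans yx).
by rewrite (le_trans yx)// (le_trans xM)// oppr_le0; exact: tame_ge0 tf.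
Qed.

(** Regularity is applied under the integral over [`]-oo, x]]; the constant
   [d] may be larger than [c], since a bound at least [1] is wanted later. *)
Lemma kop_step (d : R) f (x z : R) :
  (forall x y z, x <= y -> y <= z -> K x z <= d * (K x y + K y z))%R ->
  nonneg_measurable f -> (0 <= d)%R -> (x <= z)%R ->
  kop f z <= d%:E * (kop f x + (K x z)%:E * prim f x) +
    \int[leb]_(y in `]x, z]) (K y z * f y)%:E.
Proof.
move=> Kd nf d0 xz; rewrite {1}/kop (int_itvNyc_split xz); last 2 first.
- exact/emeas_fin/nnm_Kf.
- by move=> y; rewrite lee_fin mulr_ge0 ?nf.1.
apply: leeD2r.
rewrite -intZ ?lee_fin//; last 2 first.
- exact: emeas_fin.
- by move=> y; rewrite lee_fin nf.1.
rewrite -intD//; last 4 first.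
- exact/emeas_fin/nnm_Kf.
- by apply: emeasM; [exact: measurable_cst|exact: emeas_fin].
- by move=> y; rewrite lee_fin mulr_ge0 ?nf.1.
- by move=> y; rewrite -EFinM lee_fin mulr_ge0 ?nf.1.
have mD : emeas (fun y => (K y x * f y)%:E + (K x z)%:E * (f y)%:E).
  apply: emeasD; first exact/emeas_fin/nnm_Kf.
  by apply: emeasM; [exact: measurable_cst|exact: emeas_fin].
rewrite -intZ ?lee_fin//; last first.
  by move=> y; rewrite -EFinM -EFinD lee_fin addr_ge0// mulr_ge0 ?nf.1.
apply: le_int => //.
- exact/emeas_fin/nnm_Kf.
- by apply: emeasM => //; exact: measurable_cst.
- by move=> y _; rewrite lee_fin mulr_ge0 ?nf.1.
move=> y /=; rewrite in_itv/= => yx.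
rewrite -[(K x z)%:E * _]EFinM -EFinD -EFinM lee_fin -mulrDl mulrA.
by rewrite ler_wpM2r ?nf.1 ?Kd.
Qed.

(** * Discretization along the mass of the weight *)
Section discretization.
Variables (r : R) (om : R -> R).
Hypothesis r0 : (0 < r)%R.
Hypothesis om0 : (forall x, 0 <= om x)%R.
Hypothesis omn : {homo om : x y / (x <= y)%R >-> (y <= x)%R}.

Definition wint w (G : R -> \bar R) (D : set R) : \bar R :=
  \int[leb]_(x in D) (G x `^ r * (w x)%:E).

Lemma emeas_wint w G : nonneg_measurable w -> {homo G : x y / (x <= y)%R >-> x <= y} ->
  emeas (fun x => G x `^ r * (w x)%:E).
Proof.
by move=> nw Gh; apply: emeasM; [apply/emeas_pow/emeas_homo|exact: emeas_fin].
Qed.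

Lemma wint_integrand_ge0 w G x : nonneg_measurable w -> 0 <= G x `^ r * (w x)%:E.
Proof. by move=> nw; rewrite mule_ge0 ?poweR_ge0 ?lee_fin ?nw.1. Qed.

Lemma wint_oc_le w G (s t : R) : nonneg_measurable w ->
  {homo G : x y / (x <= y)%R >-> x <= y} -> (forall x, 0 <= G x) ->
  wint w G `]s, t] <= G t `^ r * \int[leb]_(x in `]s, t]) (w x)%:E.
Proof.
move=> nw Gh G0; rewrite -intZ ?poweR_ge0//; last 2 first.
- exact: emeas_fin.
- by move=> x; rewrite lee_fin nw.1.
apply: le_int => //.
- exact: emeas_wint.
- by apply: emeasM; [exact: measurable_cst|exact: emeas_fin].
- by move=> x _; exact: wint_integrand_ge0.
- move=> x /=; rewrite in_itv/= => /andP[_ xt].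
  rewrite lee_wpmul2r ?lee_fin ?nw.1//.
  by apply: poweR_le; rewrite ?(ltW r0)// Gh.
Qed.

Lemma wint_oc_ge w G (s t : R) : nonneg_measurable w ->
  {homo G : x y / (x <= y)%R >-> x <= y} -> (forall x, 0 <= G x) ->
  G s `^ r * \int[leb]_(x in `]s, t]) (w x)%:E <= wint w G `]s, t].
Proof.
move=> nw Gh G0; rewrite -intZ ?poweR_ge0//; last 2 first.
- exact: emeas_fin.
- by move=> x; rewrite lee_fin nw.1.
apply: le_int => //.
- by apply: emeasM; [exact: measurable_cst|exact: emeas_fin].
- exact: emeas_wint.
- by move=> x _; rewrite mule_ge0 ?poweR_ge0 ?lee_fin ?nw.1.
- move=> x /=; rewrite in_itv/= => /andP[sx _].
  rewrite lee_wpmul2r ?lee_fin ?nw.1//.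
  by apply: poweR_le; rewrite ?(ltW r0)// Gh// ltW.
Qed.

Lemma wint_itvNyc_split w G (s t : R) : nonneg_measurable w ->
  {homo G : x y / (x <= y)%R >-> x <= y} -> (s <= t)%R ->
  wint w G `]-oo, t] = wint w G `]-oo, s] + wint w G `]s, t].
Proof.
move=> nw Gh st; apply: int_itvNyc_split => //; first exact: emeas_wint.
by move=> x; exact: wint_integrand_ge0.
Qed.

Lemma wint_tame M w G : tame M w -> {homo G : x y / (x <= y)%R >-> x <= y} ->
  wint w G setT = wint w G `](- M)%R, M].
Proof.
move=> tw Gh; have [nw _ w0] := tw.
have M0 := tame_ge0 tw.
have NM : (- M <= M)%R by rewrite ge0_cp.
have -> : wint w G setT = wint w G `]-oo, M].
  have -> : [set: lebesgueR R] = `]-oo, M] `|` `]M, +oo[.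
    apply/seteqP; split => x _ //=; rewrite !in_itv/= andbT.
    by case: (leP x M); [left|right].
  rewrite /wint int_split//.
  - rewrite [X in _ + X]integral0_eq ?adde0// => x /=; rewrite in_itv/= andbT => yx.
    by rewrite w0 ?mule0// ger0_norm ?(ltW yx)// (le_trans M0)// ltW.
  - exact: emeas_wint.
  - by move=> x; exact: wint_integrand_ge0.
  - by move=> x /=; rewrite !in_itv/= andbT leNgt => /negP.
rewrite (wint_itvNyc_split nw Gh NM) [X in X + _]integral0_eq ?add0e// => x /=.
rewrite in_itv/= => xM; rewrite w0 ?mule0// ler0_norm; first by rewrite lerNr.
by rewrite (le_trans xM)// oppr_le0.
Qed.

Lemma le_wint w G H (D : set R) : nonneg_measurable w -> mset D ->
  {homo G : x y / (x <= y)%R >-> x <= y} ->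
  {homo H : x y / (x <= y)%R >-> x <= y} -> (forall x, 0 <= G x) ->
  (forall x, G x <= H x) -> wint w G D <= wint w H D.
Proof.
move=> nw mD Gh Hh G0 GH; apply: le_int => //.
- exact: emeas_wint.
- exact: emeas_wint.
- by move=> x _; exact: wint_integrand_ge0.
- move=> x _; rewrite lee_wpmul2r ?lee_fin ?nw.1//.
  by apply: poweR_le; rewrite ?(ltW r0).
Qed.

Lemma le_wint_sub w G (A B : set R) : nonneg_measurable w -> mset A -> mset B ->
  {homo G : x y / (x <= y)%R >-> x <= y} -> A `<=` B -> wint w G A <= wint w G B.
Proof.
move=> nw mA mB Gh AB; apply: le_int_sub => //; first exact: emeas_wint.
by move=> x; exact: wint_integrand_ge0.
Qed.

Local Notation c0 := (Num.max c 1%R).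
Local Notation a := (disc_base c r).

Let c0_ge1 : (1 <= c0)%R. Proof. by rewrite le_max lexx orbT. Qed.

Let a_ge2 : (2 <= a)%R.
Proof.
have h : (1 <= 3 * c0)%R by have := c0_ge1; lra.
suff : (1 <= (3 * c0) `^ r)%R by rewrite /disc_base; lra.
apply: (@le_trans _ _ (1 `^ r)%R); first by rewrite powR1.
apply: ge0_ler_powR; rewrite ?nnegrE ?(ltW r0)//.
exact: le_trans h.
Qed.

Lemma pow_split (A t X : R) : (0 <= A)%R -> (0 <= t)%R -> (0 <= X)%R ->
  (X <= c0 * (A + 2 * t))%R -> (2 * X `^ r <= a * (A `^ r + t `^ r))%R.
Proof.
move=> A0 t0 X0 hX; rewrite /disc_base -mulrA ler_pM2l//.
have c00 : (0 <= c0)%R by exact: le_trans c0_ge1.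
pose m := Num.max A t.
have Am : (A <= m)%R by rewrite le_max lexx.
have tm : (t <= m)%R by rewrite le_max lexx orbT.
have m0 : (0 <= m)%R by exact: le_trans Am.
apply: (@le_trans _ _ ((3 * c0 * m) `^ r)%R).
  apply: ge0_ler_powR; rewrite ?nnegrE ?mulr_ge0 ?(ltW r0)//.
  apply: le_trans hX _; rewrite [(3 * c0)%R]mulrC -mulrA ler_wpM2l//; lra.
rewrite powRM ?mulr_ge0// ler_wpM2l ?powR_ge0// /m /Num.max.
by case: ifP => _; rewrite ?lerDl ?lerDr powR_ge0.
Qed.

(** The points beyond which [w] has mass [W / a ^ k]. *)
Lemma geometric_levels M w (W : R) : tame M w -> prim w M = W%:E -> (0 <= W)%R ->
  exists x : nat -> R, x 0%N = (- M)%R /\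
    forall k, prim w (x k) = (W * (1 - a^-1 ^+ k))%:E.
Proof.
move=> tw wM W0.
have a0 : (0 < a)%R by apply: lt_le_trans a_ge2.
have z1 k : (0 <= 1 - a^-1 ^+ k <= 1)%R.
  rewrite subr_ge0 gerBl exprn_ge0 ?invr_ge0 ?(ltW a0)// andbT.
  rewrite exprn_ile1// ?invr_ge0 ?(ltW a0)// invf_le1//.
  by rewrite (le_trans _ a_ge2)// ler1n.
have /choice[x xP] : forall k : nat, exists s,
    (k = 0%N -> s = - M)%R /\ prim w s = (W * (1 - a^-1 ^+ k))%:E.
  move=> [|k].
    by exists (- M)%R; rewrite expr0 subrr mulr0 (prim_tame_low tw).
  have [/andP[h1 h2]] := z1 k.+1.
  have [||s ws] := @prim_level M w tw (W * (1 - a^-1 ^+ k.+1))%R.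
  - by rewrite mulr_ge0.
  - by rewrite wM lee_fin ler_piMr.
  - by exists s.
by exists x; split=> [|k]; [exact: (xP 0%N).1|exact: (xP k).2].
Qed.

Lemma ge0_le_addey (x y : \bar R) : 0 <= y -> x <= y + +oo.
Proof. by case: y => // [y|] _; rewrite leey. Qed.

(** The bookkeeping of one step of the induction.  With [z = a ^ (- m)], the
   surplus [W * a * z * s] kept from the previous step, where [s] is the
   [r]-th power of the integral operator at the previous point, pays for twice
   [W * z * s'] up to the term in [t]: once for the integral [I] over the new
   interval, once for the new surplus.  The term in [t] is paid by [J]. *)
Lemma step_arith (L I R1 J : \bar R) (W z s s' t : R) :
  (0 <= W)%R -> (0 <= z)%R -> (0 <= t)%R -> (2 * s' <= a * (s + t))%R ->
  I <= (W * z * s')%:E -> L + (W * a * z * s)%:E <= R1 ->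
  (t * (W * (a^-1 * z * (1 - a^-1))))%:E <= J ->
  L + I + (W * a * (a^-1 * z) * s')%:E <= R1 + (2 * a ^+ 2)%:E * J.
Proof.
move=> W0 z0 t0 hs hI hL hJ.
have a0 : (0 < a)%R by apply: lt_le_trans a_ge2.
have az : (a * a^-1 = 1)%R by rewrite divff// gt_eqF.
have Wz : (0 <= W * z)%R by rewrite mulr_ge0.
apply: (@le_trans _ _ (L + (W * a * z * s)%:E + (W * a * z * t)%:E)).
  rewrite -!addeA; apply: leeD2l.
  apply: (@le_trans _ _ ((W * z * s')%:E + (W * z * s')%:E)).
    apply: leeD => //; rewrite lee_fin.
    rewrite [leLHS](_ : _ = W * z * s' * (a * a^-1))%R; last ring.
    by rewrite az mulr1.
  rewrite -!EFinD lee_fin; have := ler_wpM2l Wz hs.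
  rewrite (_ : W * z * (2 * s') = W * z * s' + W * z * s')%R; last ring.
  by rewrite (_ : W * z * (a * (s + t)) = W * a * z * s + W * a * z * t)%R//; ring.
apply: leeD => //.
apply: (@le_trans _ _ ((2 * a ^+ 2)%:E * (t * (W * (a^-1 * z * (1 - a^-1))))%:E)); last first.
  by rewrite lee_wpmul2l// lee_fin mulr_ge0// exprn_ge0// ltW.
rewrite -EFinM lee_fin.
rewrite [leRHS](_ : _ = W * a * z * t * (a * a^-1) * (2 * (1 - a^-1)))%R; last ring.
have Wazt : (0 <= W * a * z * t)%R.
  by apply: mulr_ge0 => //; apply: mulr_ge0 => //; apply: mulr_ge0 => //; exact: ltW.
rewrite az mulr1 ler_peMr//.
have : (a^-1 <= 2^-1)%R by rewrite lef_pV2 ?posrE ?a_ge2.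
have : (2^-1 * 2 = 1 :> R)%R by rewrite mulVf.
lra.
Qed.

(** The second summand on the left is the surplus that makes the induction
   work.  The supremum operator is integrated one interval further than the
   integral operator: its value at [x m.+1] is used on
   [`]x m.+1, x m.+2]]. *)
Lemma kop_supop_step M f w (W : R) (x : nat -> R) : tame M f -> tame M w ->
  (0 < W)%R -> x 0%N = (- M)%R ->
  (forall k, prim w (x k) = (W * (1 - a^-1 ^+ k))%:E) ->
  forall (m : nat) e, (0 < e)%R -> exists h, [/\ nonneg_measurable h,
    \int[leb]_t (h t * om t)%:E <= \int[leb]_t (f t * om t)%:E +
      \int[leb]_(t in `]-oo, x m]) (f t * om t)%:E + e%:E &
    (forall t, f t <= h t)%R /\
    wint w (kop f) `]-oo, x m] + (W * a * a^-1 ^+ m * fine (kop f (x m)) `^ r)%:E <=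
    (2 * a ^+ 2)%:E * wint w (supop K h) `]-oo, x m.+1]].
Proof.
move=> tf tw W0 x0 wx; have [nf _ _] := tf; have [nw _ w0] := tw.
have a0 : (0 < a)%R by apply: lt_le_trans a_ge2.
have z0 : (0 < a^-1)%R by rewrite invr_gt0.
have z2 : (a^-1 <= 2^-1)%R by rewrite lef_pV2 ?posrE ?a_ge2.
have kap0 : 0 <= (2 * a ^+ 2)%:E :> \bar R.
  by rewrite lee_fin mulr_ge0// exprn_ge0// ltW.
have lev_lt k : (W * (1 - a^-1 ^+ k) < W * (1 - a^-1 ^+ k.+1))%R.
  rewrite ltr_pM2l// ltrD2l ltrN2 exprS gtr_pMl ?exprn_gt0//.
  by apply: le_lt_trans z2 _; rewrite invf_lt1// ltr1n.
have xlt k : (x k < x k.+1)%R by exact: level_lt tw (wx k) (wx k.+1) (lev_lt k).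
have wI k : \int[leb]_(t in `]x k, x k.+1]) (w t)%:E =
    (W * (a^-1 ^+ k * (1 - a^-1)))%:E.
  rewrite (int_level tw (wx k) (wx k.+1) (lev_lt k)); congr (_%:E).
  by rewrite exprS; ring.
have sup_homo h : nonneg_measurable h -> {homo supop K h : x y / (x <= y)%R >-> x <= y}.
  by move=> nh; exact: supop_homo.
elim=> [|m IH] e e0.
  exists f; split; first exact: nf.
    by rewrite x0 -addeA leeDl// adde_ge0 ?lee_fin ?(ltW e0)//;
      apply: integral_ge0 => t _; rewrite lee_fin mulr_ge0 ?nf.1.
  split => //; rewrite {1 2}x0 (kop_tame_low tf)// powR0 ?gt_eqF// mulr0 adde0.
  rewrite [X in X <= _]integral0_eq.
    by rewrite mule_ge0//; apply: integral_ge0 => t _; exact: wint_integrand_ge0.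
  move=> t /=; rewrite in_itv/= => tM; rewrite w0 ?mule0// ler0_norm.
    by rewrite lerNr.
  by rewrite (le_trans tM)// oppr_le0; exact: tame_ge0 tw.
have e2 : (0 < e / 2)%R by rewrite divr_gt0.
have [h [nh costh [fh IHh]]] := IH _ e2.
have [g [t [ng tx Pg costg]]] := @concentrate_mass (fun y => K y (x m.+1)) om
  (fun y => K0 y _) (fun y1 y2 => @K1 _ y1 y2) om0 omn _ _ _ _ _ tf (xlt m) e2.
have nhg := nnmD nh ng.
exists (fun y => h y + g y)%R; split; first exact: nhg.
  under eq_integral do rewrite mulrDl EFinD.
  rewrite intD//; last 4 first.
  - exact: (emeas_om om0 omn).
  - exact: (emeas_om om0 omn).
  - by move=> y; rewrite lee_fin mulr_ge0 ?nh.1.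
  - by move=> y; rewrite lee_fin mulr_ge0 ?ng.1.
  rewrite [X in _ <= _ + X + _](int_itvNyc_split (ltW (xlt m))); last 2 first.
  - exact: (emeas_om om0 omn).
  - by move=> y; rewrite lee_fin mulr_ge0 ?nf.1.
  apply: le_trans (leeD costh costg) _.
  by rewrite addeACA -EFinD -splitr addeA.
split.
  by move=> y; rewrite (le_trans (fh y))// lerDl ng.1.
set H := (fun y => h y + g y)%R in nhg *.
have hH y : (h y <= H y)%R by rewrite lerDl ng.1.
have gH y : (g y <= H y)%R by rewrite lerDr nh.1.
set L := wint w (kop f) `]-oo, x m] in IHh.
set A := fine (kop f (x m)) in IHh.
have AE : kop f (x m) = A%:E by rewrite fineK// (kop_fin _ tf).
set A' := fine (kop f (x m.+1)).
have AE' : kop f (x m.+1) = A'%:E by rewrite fineK// (kop_fin _ tf).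
have A0 : (0 <= A)%R by rewrite fine_ge0// kop_ge0.
have A0' : (0 <= A')%R by rewrite fine_ge0// kop_ge0.
rewrite (wint_itvNyc_split nw (kop_homo nf) (ltW (xlt m))) -/L.
rewrite (wint_itvNyc_split nw (sup_homo _ nhg) (ltW (xlt m.+1))).
set J := wint w (supop K H) `]x m.+1, x m.+2].
set I := wint w (kop f) `]x m, x m.+1].
have HI : I <= (W * a^-1 ^+ m * A' `^ r)%:E.
  apply: le_trans (wint_oc_le _ _ nw (kop_homo nf) (fun y => kop_ge0 y nf)) _.
  rewrite AE' poweR_EFin wI -EFinM lee_fin mulrC ler_wpM2r ?powR_ge0//.
  rewrite ler_wpM2l ?(ltW W0)// ler_piMr ?exprn_ge0 ?(ltW z0)//.
  by rewrite gerBl ltW.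
set tau := supop K H (x m.+1).
have tau0 : 0 <= tau by exact: supop_ge0.
have HJ : tau `^ r * (W * (a^-1 ^+ m.+1 * (1 - a^-1)))%:E <= J.
  rewrite -wI.
  exact: (wint_oc_ge _ _ nw (sup_homo _ nhg) (fun y => supop_ge0 K0 K1 y nhg)).
have R1H : (2 * a ^+ 2)%:E * wint w (supop K h) `]-oo, x m.+1] <=
           (2 * a ^+ 2)%:E * wint w (supop K H) `]-oo, x m.+1].
  apply: (lee_wpmul2l kap0).
  exact: (le_wint nw (mset_itv _) (sup_homo _ nh) (sup_homo _ nhg)
    (fun y => supop_ge0 K0 K1 y nh) (fun y => le_supop K0 K1 y nh nhg hH)).
have Wz0 k : (0 < W * (a^-1 ^+ k * (1 - a^-1)))%R.
  rewrite !mulr_gt0 ?exprn_gt0// subr_gt0.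
  by apply: le_lt_trans z2 _; rewrite invf_lt1// ltr1n.
have intge0 D : 0 <= wint w (supop K H) D.
  by apply: integral_ge0 => y _; exact: wint_integrand_ge0.
have Jge0 : 0 <= J by exact: intge0.
rewrite ge0_muleDr//.
have c0c : (0 <= c0)%R by exact: le_trans c0_ge1.
have Kreg0 y1 y2 y3 : (y1 <= y2 -> y2 <= y3 -> K y1 y3 <= c0 * (K y1 y2 + K y2 y3))%R.
  move=> h1 h2; apply: le_trans (Kreg h1 h2) _; rewrite ler_wpM2r ?addr_ge0//.
  by rewrite le_max lexx.
have Btau : (K (x m) (x m.+1))%:E * prim f (x m) <= tau.
  apply: le_trans (supop_ge K0 K1 nhg (ltW (xlt m))).
  rewrite lee_wpmul2l ?lee_fin//; apply: le_prim => // y.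
  exact: le_trans (fh y) (hH y).
have Dtau : \int[leb]_(y in `]x m, x m.+1]) (K y (x m.+1) * f y)%:E <= tau.
  under eq_integral do rewrite mulrC.
  apply: le_trans Pg _; apply: le_trans (supop_ge K0 K1 nhg tx).
  by rewrite lee_wpmul2l ?lee_fin//; exact: le_prim.
move: HJ Btau Dtau tau0; case: tau => [th| |//].
  rewrite lee_fin poweR_EFin -EFinM => HJ Btau Dtau th0.
  have HA : (A' <= c0 * (A + 2 * th))%R.
    rewrite -lee_fin -AE'; apply: le_trans (kop_step Kreg0 nf c0c (ltW (xlt m))) _.
    apply: (@le_trans _ _ (c0%:E * (A%:E + th%:E) + th%:E)).
      apply: leeD Dtau; rewrite lee_wpmul2l ?lee_fin// AE; exact: leeD2l.
    rewrite [leLHS](_ : _ = (c0 * (A + th) + th)%:E)// lee_fin.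
    have := ler_wpM2r th0 c0_ge1; rewrite mul1r => h2.
    by rewrite mulrDr [leRHS]mulrDr -addrA lerD2l mulrCA mulr_natl mulr2n lerD2l.
  have HP := pow_split A0 th0 A0' HA.
  rewrite exprS in HJ; rewrite exprS.
  apply: (step_arith (ltW W0) _ (powR_ge0 th r) HP HI (le_trans IHh R1H) HJ).
  by rewrite exprn_ge0 ?(ltW z0).
(* The supremum operator may be infinite at [x m.+1], and then so is [J]. *)
rewrite poweRyr ?gt_eqF// gt0_mulye ?lte_fin//.
rewrite leye_eq => /eqP -> _ _ _.
rewrite [_ * +oo]gt0_muley; last first.
  by rewrite lte_fin; apply: mulr_gt0 => //; exact: exprn_gt0.
exact: (ge0_le_addey _ (mule_ge0 kap0 (intge0 _))).
Qed.

(** The induction never reaches the total mass of [w]; it is stopped when the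
   remaining mass contributes at most [e]. *)
Lemma kop_supop M f w e : tame M f -> tame M w -> (0 < e)%R ->
  exists h, [/\ nonneg_measurable h,
    \int[leb]_t (h t * om t)%:E <= 2%:E * \int[leb]_t (f t * om t)%:E + e%:E &
    wint w (kop f) setT <= (2 * a ^+ 2)%:E * wint w (supop K h) setT + e%:E].
Proof.
move=> tf tw e0; have [nf _ _] := tf; have [nw _ _] := tw.
have a0 : (0 < a)%R by apply: lt_le_trans a_ge2.
have kap0 : 0 <= (2 * a ^+ 2)%:E :> \bar R.
  by rewrite lee_fin mulr_ge0// exprn_ge0// ltW.
have M0 := tame_ge0 tw.
have NM : (- M <= M)%R by rewrite ge0_cp.
have om_ge0 D : 0 <= \int[leb]_(t in D) (f t * om t)%:E.
  by apply: integral_ge0 => t _; rewrite lee_fin mulr_ge0 ?nf.1.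
have WE : prim w M = (fine (prim w M))%:E by rewrite fineK// (prim_tame_fin tw).
have W0 : (0 <= fine (prim w M))%R by rewrite fine_ge0// prim_ge0.
move: WE W0; set W := fine _ => WE.
rewrite le_eqVlt => /predU1P[W0|W0].
  exists f; split; first exact: nf.
    apply: (@le_trans _ _ (1%:E * \int[leb]_t (f t * om t)%:E)); first by rewrite mul1e.
    apply: (@le_trans _ _ (2%:E * \int[leb]_t (f t * om t)%:E)).
      by rewrite lee_wpmul2r// lee_fin ler1n.
    by rewrite leeDl// lee_fin ltW.
  rewrite (wint_tame tw (kop_homo nf)).
  apply: le_trans (wint_oc_le _ _ nw (kop_homo nf) (fun y => kop_ge0 y nf)) _.
  rewrite (_ : \int[leb]_(y in _) _ = 0) ?mule0; last first.
    apply/eqP; rewrite eq_le; apply/andP; split; last first.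
      by apply: integral_ge0 => t _; rewrite lee_fin nw.1.
    rewrite [X in _ <= X](_ : _ = prim w M); last by rewrite WE -W0.
    apply: le_int_sub => //; first exact: emeas_fin.
      by move=> t; rewrite lee_fin nw.1.
    by move=> t /=; rewrite !in_itv/= => /andP[].
  rewrite adde_ge0 ?lee_fin ?(ltW e0)// mule_ge0//.
  by apply: integral_ge0 => y _; exact: wint_integrand_ge0.
have [x [x0 wx]] := geometric_levels tw WE (ltW W0).
set AM := fine (kop f M).
have AME : kop f M = AM%:E by rewrite fineK// (kop_fin _ tf).
have AM0 : (0 <= AM)%R by rewrite fine_ge0// kop_ge0.
have [m Hm] : exists m : nat, (AM `^ r * (W * a^-1 ^+ m) <= e)%R.
  have z1 : (`|a^-1| < 1)%R.
    rewrite ger0_norm ?invr_ge0 ?(ltW a0)// invf_lt1//.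
    by apply: lt_le_trans a_ge2; rewrite ltr1n.
  have /cvgrPdist_le/(_ e e0)[m _ /(_ m (leqnn m))] := cvg_geometric (AM `^ r * W)%R z1.
  rewrite sub0r normrN /geometric/= => hm; exists m.
  by apply: le_trans hm; rewrite mulrA ler_norm.
have [h [nh costh [_ hm]]] := kop_supop_step tf tw W0 x0 wx m e0.
exists h; split; first exact: nh.
  apply: le_trans costh _; rewrite leeD2r//.
  rewrite -[2%R]/(1 + 1)%R EFinD ge0_muleDl// mul1e leeD2l//.
  exact: (le_int_om om0 omn).
have xM : (x m <= M)%R.
  rewrite leNgt; apply/negP => /ltW/(prim_homo nw); rewrite WE wx lee_fin leNgt.
  rewrite -[X in (_ < X)%R](mulr1) ltr_pM2l// gtrBl exprn_gt0 ?invr_gt0//.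
have suph : {homo supop K h : x y / (x <= y)%R >-> x <= y} by exact: supop_homo.
rewrite (wint_tame tw (kop_homo nf)).
apply: (@le_trans _ _ (wint w (kop f) `]-oo, M])).
  apply: le_wint_sub => //; first exact: kop_homo.
  by move=> t /=; rewrite !in_itv/= => /andP[].
rewrite (wint_itvNyc_split nw (kop_homo nf) xM); apply: leeD.
  apply: le_trans (_ : (2 * a ^+ 2)%:E * wint w (supop K h) `]-oo, x m.+1] <= _).
    apply: le_trans hm; rewrite leeDl// lee_fin.
    by rewrite !mulr_ge0 ?exprn_ge0 ?powR_ge0 ?invr_ge0// ltW.
  by rewrite lee_wpmul2l//; exact: le_wint_sub.
apply: le_trans (wint_oc_le _ _ nw (kop_homo nf) (fun y => kop_ge0 y nf)) _.
rewrite AME poweR_EFin.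
have [->|xM'] := eqVneq (x m) M.
  by rewrite set_itvoc0 integral_set0 mule0 lee_fin ltW.
rewrite (int_level tw (wx m) WE); last first.
  by rewrite -[X in (_ < X)%R](mulr1) ltr_pM2l// gtrBl exprn_gt0 ?invr_gt0.
rewrite -EFinM lee_fin (_ : (W - _)%R = (W * a^-1 ^+ m)%R)//; ring.
Qed.

End discretization.
End kernel_operator.

(** * The function sigma and its negative powers *)
Lemma int_indic (A D : set R) (k : R -> R) : D `<=` A ->
  \int[leb]_(y in A) (k y * \1_D y)%:E = \int[leb]_(y in D) (k y)%:E.
Proof.
move=> DA; rewrite integral_mkcond [RHS]integral_mkcond.
apply: eq_integral => y _; rewrite !patchE indicE.
have [yD|yD] := boolP (y \in D); last by rewrite mulr0 if_same.
by rewrite mulr1 ifT// inE; apply: DA; rewrite -inE.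
Qed.

Lemma negpowE (t s : R) : (0 <= t)%R -> (0 < s)%R ->
  negpow t%:E s = if t == 0%R then +oo else (t `^ (- s))%:E.
Proof.
move=> t0 s0; rewrite /negpow poweR_EFin inver powR_eq0 (gt_eqF s0) andbT.
by case: ifPn => // _; rewrite powRN.
Qed.

Lemma negpow_ge0 (x : \bar R) (s : R) : 0 <= negpow x s.
Proof. by rewrite /negpow inve_ge0 poweR_ge0. Qed.

Lemma negpow_gt0 (t s : R) : (0 <= t)%R -> (0 < s)%R -> 0 < negpow t%:E s.
Proof.
move=> t0 s0; rewrite negpowE//; case: ifPn => [_|tn0]; first by rewrite ltry.
by rewrite lte_fin powR_gt0// lt_neqAle eq_sym tn0.
Qed.

Lemma negpow_le (x y : \bar R) (s : R) : (0 <= s)%R -> 0 <= x -> x <= y ->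
  negpow y s <= negpow x s.
Proof.
move=> s0 x0 xy; rewrite /negpow lee_pV2 ?inE ?poweR_ge0//.
exact: poweR_le.
Qed.

Lemma negpow_lty (x : \bar R) (s : R) : 0 < x -> negpow x s < +oo.
Proof.
move=> x0; rewrite /negpow ltey inve_eqy gt_eqF//; exact: poweR_gt0.
Qed.

Lemma emeas_negpow f (s : R) : nonneg_measurable f -> (0 < s)%R ->
  emeas (fun y => negpow (f y)%:E s).
Proof.
move=> [f0 mf] s0.
rewrite (_ : (fun y => _) = (fun y => if f y == 0%R then +oo else (f y `^ (- s))%:E)); last first.
  by apply/funext => y; rewrite negpowE.
have m1 : measurable_fun [set: lebesgueR R] (fun y => f y == 0%R).
  exact: measurable_fun_eqr mf (measurable_cst _).
have m2 : emeas (fun y => (f y `^ (- s))%:E).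
  exact/measurable_EFinP/(measurableT_comp (measurable_powR (- s)) mf).
exact: (measurable_fun_ifT m1 (measurable_cst (+oo : \bar R)) m2).
Qed.

Lemma not_null_oc (a b : R) (N : set R) : (a < b)%R -> mset N -> leb N = 0 ->
  ~ (`]a, b]%classic `<=` N).
Proof.
move=> ab mN N0 sub.
have : leb `]a, b] <= leb N by apply: le_measure; rewrite ?inE//; exact: mset_itv.
by rewrite N0 leb_oc ?(ltW ab)// lee_fin subr_le0 leNgt ab.
Qed.

Lemma int_cst (D : set R) (c : \bar R) : mset D ->
  \int[leb]_(y in D) c = c * leb D.
Proof. by move=> mD; exact: integral_cst. Qed.

Lemma leb_setU_null (A B : set R) : mset A -> mset B -> leb A = 0 -> leb B = 0 ->
  leb (A `|` B) = 0.
Proof. by move=> mA mB A0 B0; rewrite -A0; exact: measureU0. Qed.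

Section sigma.
Variables (p : R) (v : R -> R).
Hypothesis p1 : (1 <= p)%R.
Hypothesis nv : nonneg_measurable v.

Let p0 : (0 < p)%R. Proof. exact: lt_le_trans p1. Qed.

Definition sig (x : R) : \bar R := sigma p v -oo x%:E.

Lemma sig_itv (x : R) : [set y : R | -oo < y%:E < x%:E] = `]-oo, x[%classic.
Proof. by apply/seteqP; split => y /=; rewrite in_itv/= ltNyr lte_fin. Qed.

Lemma sig1 x : p = 1%R ->
  sig x = ess_sup_on `]-oo, x[ (fun y => negpow (v y)%:E 1).
Proof. by move=> pE; rewrite /sig /sigma pE eqxx sig_itv. Qed.

Let s : R := (conj_exp p - 1)%R.

Lemma sigp x : p != 1%R ->
  sig x = (\int[leb]_(y in `]-oo, x[) negpow (v y)%:E s) `^ (conj_exp p)^-1.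
Proof. by move=> pE; rewrite /sig /sigma (negbTE pE) sig_itv. Qed.

Lemma conj_exp_facts : p != 1%R ->
  [/\ (0 < s)%R, (0 < conj_exp p)%R, (s * (p - 1) = 1)%R,
      (p * (conj_exp p)^-1 = p - 1)%R & (p^-1 * conj_exp p = s)%R].
Proof.
move=> pn1; have pm : (0 < p - 1)%R by rewrite subr_gt0 lt_neqAle eq_sym pn1.
have pn0 : p != 0%R by rewrite gt_eqF.
have pmn0 : (p - 1 != 0)%R by rewrite gt_eqF.
have sE : s = ((p - 1)^-1)%R.
  by rewrite /s /conj_exp; field.
split.
- by rewrite sE invr_gt0.
- by rewrite /conj_exp divr_gt0.
- by rewrite sE mulVf.
- by rewrite /conj_exp invf_div mulrCA divff// mulr1.
- by rewrite sE /conj_exp mulrA mulVf// mul1r.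
Qed.

Lemma int_negpow_ge0 (D : set R) (u : R) : 0 <= \int[leb]_(y in D) negpow (v y)%:E u.
Proof. by apply: integral_ge0 => y _; exact: negpow_ge0. Qed.

Lemma sig_ge0 x : 0 <= sig x.
Proof.
have [pE|pE] := eqVneq p 1%R; last by rewrite sigp// poweR_ge0.
rewrite sig1//; apply: ess_sup_gee; first exact: leb_setT.
by apply: aeW => y; rewrite patchE; case: ifP => // _; exact: negpow_ge0.
Qed.

(** A real-valued weight is nowhere infinite, so that its negative powers vanish
   nowhere.  Consequently the negative powers of [sig] are finite. *)
Lemma sig_gt0 x : 0 < sig x.
Proof.
have [pE|pE] := eqVneq p 1%R.
  rewrite ltNge sig1//; apply/negP => /ess_supP[N [mN N0 sub]].
  apply: (@not_null_oc (x - 2) (x - 1) N) => //; first by rewrite ltrD2l ltrN2 ltr1n.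
  move=> y /=; rewrite in_itv/= => /andP[_ yx]; apply: sub => /=.
  rewrite patchE mem_set/=; last by rewrite in_itv/= (le_lt_trans yx)// ltrBlDr ltrDl.
  by apply/negP; rewrite -ltNge negpow_gt0 ?nv.1.
have [s0 _ _ _ _] := conj_exp_facts pE.
rewrite sigp//; apply: poweR_gt0; rewrite lt_neqAle int_negpow_ge0 andbT.
apply/eqP => Z0.
have mF : @measurable_fun _ _ (lebesgueR R) _ `]-oo, x[ (fun y => negpow (v y)%:E s).
  by apply: measurable_funTS; exact: emeas_negpow.
have := (ae_eq_integral_abs leb (mset_itv `]-oo, x[) mF).1.
have -> : \int[leb]_(y in `]-oo, x[) `|negpow (v y)%:E s| =
    \int[leb]_(y in `]-oo, x[) negpow (v y)%:E s.
  by apply: eq_integral => y _; rewrite gee0_abs// negpow_ge0.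
move=> /(_ (esym Z0))[N [mN N0 sub]].
apply: (@not_null_oc (x - 2) (x - 1) N) => //; first by rewrite ltrD2l ltrN2 ltr1n.
move=> y /=; rewrite in_itv/= => /andP[_ yx]; apply: sub => /= /(_ _) h.
have : negpow (v y)%:E s = 0.
  by apply: h; rewrite in_itv/= (le_lt_trans yx)// ltrBlDr ltrDl.
by apply/eqP; rewrite gt_eqF// negpow_gt0 ?nv.1.
Qed.

Lemma sig_homo : {homo sig : x y / (x <= y)%R >-> x <= y}.
Proof.
move=> x y xy; have [pE|pE] := eqVneq p 1%R.
  rewrite !sig1//; apply: le_ess_sup; apply: aeW => t; rewrite !patchE.
  case: ifP => [/set_mem/= tx|_]; last by case: ifP => // _; exact: negpow_ge0.
  by rewrite mem_set//= in_itv/= (lt_le_trans _ xy)//; move: tx; rewrite in_itv.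
have [s0 q0 _ _ _] := conj_exp_facts pE.
rewrite !sigp//; apply: poweR_le; rewrite ?int_negpow_ge0 ?invr_ge0 ?(ltW q0)//.
apply: le_int_sub => //.
- exact: emeas_negpow.
- by move=> t; exact: negpow_ge0.
- by move=> t /=; rewrite !in_itv/= => /lt_le_trans->.
Qed.

Definition om (x : R) : R := fine (negpow (sig x) p).

Lemma omE x : negpow (sig x) p = (om x)%:E.
Proof.
rewrite /om fineK// ge0_fin_numE ?negpow_ge0//.
by apply: negpow_lty; exact: sig_gt0.
Qed.

Lemma om_ge0 x : (0 <= om x)%R.
Proof. by rewrite /om fine_ge0// negpow_ge0. Qed.

Lemma om_nhomo : {homo om : x y / (x <= y)%R >-> (y <= x)%R}.
Proof.
move=> x y xy; rewrite -lee_fin -!omE; apply: negpow_le.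
- exact: ltW.
- exact: sig_ge0.
- exact: sig_homo.
Qed.

(** If [sig b] is infinite then [om b = 0].  Otherwise [v] is positive almost
   everywhere to the left of [b], and there [f] is the product of
   [f * v ^ (1 / p)] and [v ^ (- 1 / p)]; for [p > 1] this is Hoelder's
   inequality, for [p = 1] a pointwise bound. *)
Lemma sigma_hoelder_bound : hoelder_bound p v om.
Proof.
move=> f a b m nf fm.
have A0 : 0 <= \int[leb]_(t in `]a, b]) (f t `^ p * v t)%:E.
  by apply: integral_ge0 => y _; exact: pv_ge0.
have m0 : (0 <= m)%R.
  by rewrite -lee_fin -fm; apply: integral_ge0 => y _; rewrite lee_fin nf.1.
have := omE b; have := sig_gt0 b; have := om_ge0 b.
case E : (sig b) => [S| |//] omb S0; last first.
  rewrite /negpow poweRyr ?gt_eqF// invey => -[<-].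
  by rewrite mulr0.
rewrite lte_fin in S0.
have Sp0 : (0 < S `^ p)%R by rewrite powR_gt0.
rewrite negpowE ?(ltW S0)// gt_eqF// => -[<-]; rewrite powRN.
rewrite EFinM lee_pdivrMr//.
have [pE|pE] := eqVneq p 1%R.
  move: E; rewrite sig1// => E.
  have [N [mN N0 subN]] := ess_sup_ge (@leb R)
    ((fun y => negpow (v y)%:E 1) \_ `]-oo, b[).
  pose N' := N `|` [set b].
  rewrite pE !powRr1 ?(ltW S0)// -fm muleC -intZ//; last 3 first.
  - by apply: (emeas_pv 1 nv).
  - by move=> x; rewrite (pv_ge0 1 nv).
  - by rewrite lee_fin ltW.
  apply: ae_ge0_le_integral.
  - exact: mset_itv.
  - by move=> x _; rewrite lee_fin nf.1.
  - by apply: measurable_funTS; exact: emeas_fin.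
  - by move=> x _; rewrite mule_ge0 ?lee_fin ?(ltW S0)// mulr_ge0 ?powR_ge0 ?nv.1.
  - by apply: measurable_funTS; apply: emeasM; [exact: measurable_cst|exact: (emeas_pv 1 nv)].
  exists N'; split.
  - by apply: measurableU => //; exact: mset_set1.
  - apply: (leb_setU_null mN _ N0); [exact: mset_set1|exact: leb_set1].
  move=> y /= nxy; have [->|yb] := eqVneq y b; first by right.
  left; apply: subN => /= vy; apply: nxy; rewrite in_itv/= => /andP[ay yb'].
  have {}yb : (y < b)%R by rewrite lt_neqAle yb.
  move: vy; rewrite patchE mem_set/= ?in_itv//= -/(ess_sup_on _ _) E.
  rewrite negpowE ?nv.1//; case: ifPn => // vy0; rewrite lee_fin => vy.
  rewrite -EFinM lee_fin powRr1 ?nf.1// mulrCA ler_peMr ?nf.1//.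
  have v0 : (0 < v y)%R by rewrite lt_neqAle eq_sym vy0 nv.1.
  by move: vy; rewrite powRN powRr1 ?nv.1// -[X in (X <= _)%R]mul1r ler_pdivrMr.
have [s0 q0 _ pq ps] := conj_exp_facts pE.
move: E; rewrite sigp//; set Z := \int[leb]_(y in _) _ => ES.
have Z0 : 0 <= Z by exact: int_negpow_ge0.
have Zfin : Z < +oo.
  by apply: (@lty_poweRy _ _ (conj_exp p)^-1); rewrite ?ES ?ltry// invr_eq0 gt_eqF.
pose E0 := `]-oo, b[%classic `&` [set y | v y = 0%R].
have mE0 : mset E0.
  apply: measurableI; first exact: mset_itv.
  have := nv.2 (mset_T) [set 0%R] (measurable_set1 _); rewrite setTI.
  by rewrite (_ : _ @^-1` _ = [set y | v y = 0%R]).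
have E00 : leb E0 = 0.
  apply/eqP; rewrite eq_le measure_ge0 andbT leNgt; apply/negP => E0p.
  have : +oo * leb E0 <= Z.
    rewrite -(integral_cst leb mE0 +oo).
    apply: (@le_trans _ _ (\int[leb]_(y in E0) negpow (v y)%:E s)).
      apply: le_int => //; [exact: measurable_cst|exact: emeas_negpow|by move=> y _; rewrite leey|].
      by move=> y [_ /= ->]; rewrite negpowE// eqxx.
    apply: le_int_sub => //; first exact: emeas_negpow.
      by move=> y; exact: negpow_ge0.
    by move=> y [].
  by rewrite gt0_mulye// leye_eq => /eqP Zy; move: Zfin; rewrite Zy.
pose D := `]a, b]%classic `\` (E0 `|` [set b]).
have mb := mset_set1 b.
have mD : mset D by apply: measurableD; [exact: mset_itv|exact: measurableU].
have vD y : D y -> (0 < v y)%R.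
  move=> [/=]; rewrite in_itv/= => /andP[_ yb] Ny.
  rewrite lt_neqAle nv.1 andbT; apply/eqP => vy; apply: Ny.
  have [->|ynb] := eqVneq y b; first by right.
  by left; split => //=; rewrite in_itv/= lt_neqAle ynb.
have fD : \int[leb]_(t in D) (f t)%:E = m%:E.
  rewrite -fm; apply/esym/ge0_negligible_integral.
  - exact: measurableU.
  - exact: mset_itv.
  - by apply: measurable_funTS; exact: emeas_fin.
  - by move=> x _; rewrite lee_fin nf.1.
  exact: (leb_setU_null mE0 mb E00 (leb_set1 b)).
pose F y := (f y * v y `^ p^-1 * \1_D y)%R.
pose G y := (v y `^ (- p^-1) * \1_D y)%R.
have nF : nonneg_measurable F.
  by apply: (nnmM (nnmM nf (nnm_pow _ nv))); exact: nnm_indic.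
have nG : nonneg_measurable G.
  by apply: (nnmM (nnm_pow _ nv)); exact: nnm_indic.
have pq1 : (p^-1 + (conj_exp p)^-1 = 1)%R.
  rewrite -[LHS](mulKf (lt0r_neq0 p0)) mulrDr pq divff ?gt_eqF//.
  by rewrite addrC subrK mulVf// gt_eqF.
have := hoelder leb nF.2 nG.2 p0 q0 pq1.
rewrite Lnorm1.
have -> : \int[leb]_x `|(EFin \o (F \* G)%R) x| = m%:E.
  rewrite -fD -(int_indic _ (@subsetT _ D)); apply: eq_integral => y _ /=.
  have FG0 : (0 <= F y * G y)%R by apply: mulr_ge0; [exact: nF.1|exact: nG.1].
  rewrite ger0_norm//; apply: (congr1 (@EFin R)).
  rewrite /F /G indicE; have [/set_mem/vD yD|_] := boolP (y \in D); last by rewrite !mulr0.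
  by rewrite !mulr1 -mulrA powRN divff ?mulr1// powR_eq0 gt_eqF.
move=> hold.
have := poweR_le (ltW p0) (_ : 0 <= m%:E) hold.
rewrite poweR_EFin poweRM ?Lnorm_ge0// powR_Lnorm ?gt_eqF// => /(_ _)/le_trans; apply.
  by rewrite lee_fin.
apply: lee_pmul.
- by apply: integral_ge0 => y _; exact: poweR_ge0.
- exact: poweR_ge0.
- have -> : \int[leb]_x (`|(EFin \o F) x| `^ p) = \int[leb]_(t in D) (f t `^ p * v t)%:E.
    rewrite -(int_indic _ (@subsetT _ D)); apply: eq_integral => y _ /=.
    rewrite ger0_norm ?nF.1//; apply: (congr1 (@EFin R)).
    rewrite /F indicE; have [/set_mem/vD yD|_] := boolP (y \in D); last first.
      by rewrite !mulr0 powR0 ?gt_eqF.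
    by rewrite !mulr1 powRM ?nf.1 ?powR_ge0// -powRrM mulVf ?gt_eqF// powRr1// ltW.
  apply: le_int_sub => //.
  + exact: emeas_pv.
  + exact: pv_ge0.
  + by move=> y [].
rewrite -poweR_EFin; apply: poweR_le; rewrite ?(ltW p0) ?Lnorm_ge0// -ES.
rewrite -[leLHS](@poweRK _ (conj_exp p)) ?gt_eqF ?Lnorm_ge0//.
rewrite powR_Lnorm ?gt_eqF//; apply: poweR_le.
- by rewrite invr_ge0 ltW.
- by apply: integral_ge0 => y _; exact: poweR_ge0.
have -> : \int[leb]_x (`|(EFin \o G) x| `^ conj_exp p) =
    \int[leb]_(y in D) (v y `^ (- s))%:E.
  rewrite -(int_indic _ (@subsetT _ D)); apply: eq_integral => y _ /=.
  rewrite ger0_norm ?nG.1//; apply: (congr1 (@EFin R)).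
  rewrite /G indicE; have [/set_mem/vD yD|_] := boolP (y \in D); last first.
    by rewrite !mulr0 powR0 ?gt_eqF.
  by rewrite !mulr1 -powRrM mulNr ps.
apply: (@le_trans _ _ (\int[leb]_(y in D) negpow (v y)%:E s)).
  apply: le_int => //.
  - exact: (emeas_fin (nnm_pow _ nv)).
  - exact: emeas_negpow.
  - by move=> y _; rewrite lee_fin powR_ge0.
  - by move=> y yD; rewrite negpowE ?nv.1// gt_eqF// vD.
apply: le_int_sub => //.
- exact: emeas_negpow.
- by move=> y; exact: negpow_ge0.
move=> y [/=]; rewrite !in_itv/= => /andP[_ yb] Ny; rewrite lt_neqAle yb andbT.
by apply/eqP => yb'; apply: Ny; right.
Qed.

(** For [p = 1], put the mass uniformly on a bounded set of positive measure
   where [v] is smaller than [th], slightly above its essential infimum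
   [om t] to the left of [t]. *)
Lemma sigma_hoelder_sharp1 : p = 1%R -> hoelder_sharp p v om.
Proof.
move=> pE t m e; rewrite le_eqVlt => /predU1P[<-|m0] e0.
  exists (fun=> 0%R); split; first exact: nnm_cst.
    by apply: integral0_eq.
  by rewrite int_zero_pv// lee_fin powR0 ?gt_eqF// mul0r add0r ltW.
pose B := (m * om t + e)%R.
have omt0 := om_ge0 t.
have B0 : (0 < B)%R by rewrite ltr_wpDl// mulr_ge0// (ltW m0).
pose th := (B / m)%R.
have th0 : (0 < th)%R by rewrite divr_gt0.
pose E (n : nat) := `](- n%:R)%R, t]%classic `&` [set y : R | (v y < th)%R].
have mE n : mset (E n).
  apply: measurableI; first exact: mset_itv.
  have := nv.2 mset_T `]-oo, th[%classic (measurable_itv _); rewrite setTI.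
  by rewrite (_ : _ @^-1` _ = [set y : R | (v y < th)%R]).
have [n En] : exists n, leb (E n) != 0.
  apply: contrapT => /forallNP h.
  have E0 n : leb (E n) = 0 by apply/eqP; apply: contrapT => /negP; exact: h.
  have : sig t <= (th^-1)%:E.
    rewrite sig1//; apply/ess_supP; exists (\bigcup_n E n); split.
    - by apply: bigcup_measurable => k _; exact: mE.
    - apply/eqP; rewrite eq_le measure_ge0 andbT.
      apply: le_trans (measure_sigma_subadditive _ mE _ _) _ => //.
        by apply: bigcup_measurable => k _; exact: mE.
      by rewrite eseries0// => k _ _; exact: E0.
    move=> y /= /negP; rewrite -ltNge patchE.
    case: ifPn => [/set_mem/= yt|_]; last by rewrite lte_fin ltNge invr_ge0 ltW.
    rewrite negpowE ?nv.1// => h2.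
    exists (Num.truncn `|y|).+1 => //; split => /=.
      rewrite in_itv/= ltW; last by move: yt; rewrite in_itv.
      rewrite andbT ltrNl; apply: le_lt_trans (ler_norm _) _.
      by rewrite normrN truncnS_gt.
    move: h2; case: ifPn => [/eqP-> //|vy0].
    have vy : (0 < v y)%R by rewrite lt_neqAle eq_sym vy0 nv.1.
    by rewrite lte_fin powRN powRr1 ?nv.1// ltf_pV2.
  move=> /(negpow_le (ltW p0) (sig_ge0 t)); rewrite omE negpowE ?invr_ge0 ?(ltW th0)//.
  rewrite invr_eq0 gt_eqF// lee_fin pE powRN powRr1 ?invr_ge0 ?(ltW th0)// invrK.
  by rewrite /th ler_pdivrMr// mulrC /B gerDl leNgt e0.
have Efin : leb (E n) < +oo.
  apply: (@le_lt_trans _ _ (leb `](- n%:R)%R, (t + n%:R)%R])).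
    apply: le_measure; rewrite ?inE; [exact: mE|exact: mset_itv|].
    move=> y [/=]; rewrite !in_itv/= => /andP[-> yt] _ /=.
    by apply: le_trans yt _; rewrite lerDl.
  have [h|h] := leP (- n%:R)%R (t + n%:R)%R; first by rewrite leb_oc// ltry.
  by rewrite set_itv_ge ?measure0// bnd_simp -leNgt ltW.
have lebE : leb (E n) = (fine (leb (E n)))%:E by rewrite fineK// ge0_fin_numE.
have : (0 < fine (leb (E n)))%R by rewrite fine_gt0// Efin andbT lt0e En measure_ge0.
move: lebE; set l := fine _ => lebE l0.
have ml0 : (0 <= m / l)%R by rewrite divr_ge0// ltW.
have nE := nnm_indic (mE n).
exists (fun y => m / l * \1_(E n) y)%R; split.
- by apply: nnmM => //; exact: nnm_cst.
- rewrite /prim (@int_indic _ _ (fun=> m / l)%R).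
    by rewrite (int_cst _ (mE n)) lebE -EFinM divfK// gt_eqF.
  by move=> y [/=]; rewrite !in_itv/= => /andP[].
rewrite pE powRr1 ?(ltW m0)// -/B.
apply: (@le_trans _ _ (\int[leb]_y (m / l * th * \1_(E n) y)%:E)).
  apply: le_int => //.
  - exact: (emeas_pv 1 nv (nnmM (nnm_cst ml0) nE)).
  - apply: emeas_fin; apply: nnmM => //; apply: nnm_cst.
    by rewrite mulr_ge0// ltW.
  - by move=> y _; exact: (pv_ge0 1 nv (fun y => m / l * \1_(E n) y)%R).
  move=> y _; rewrite lee_fin powRr1; last exact: (mulr_ge0 ml0 (nE.1 y)).
  rewrite indicE.
  have [/set_mem[_ /= vy]|_] := boolP (y \in E n); last by rewrite !mulr0 mul0r.
  by rewrite !mulr1 ler_wpM2l// ltW.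
rewrite (int_indic _ (@subsetT _ (E n))).
rewrite (int_cst _ (mE n)) lebE -EFinM.
rewrite lee_fin /th [leLHS](_ : _ = B * (m / m) * (l / l))%R; last by ring.
by rewrite !divff ?gt_eqF// !mulr1.
Qed.

(** The extremal function is proportional to [v ^ (1 - p')], but it need not
   be integrable, so that [v] is replaced by [max v (1 / n)] and the half-line
   by a bounded interval.  The integrals of these approximations exceed any
   number [Y] smaller than the integral defining [sig t], and the
   price decreases to [m ^ p * om t] as the integral grows to its limit. *)
Lemma sigma_hoelder_sharp_gt1 : p != 1%R -> hoelder_sharp p v om.
Proof.
move=> pE t m e; rewrite le_eqVlt => /predU1P[<-|m0] e0.
  exists (fun=> 0%R); split; first exact: nnm_cst.
    by apply: integral0_eq.
  by rewrite int_zero_pv// lee_fin powR0 ?gt_eqF// mul0r add0r ltW.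
have [s0 q0 sp pq ps] := conj_exp_facts pE.
have pm0 : (0 < p - 1)%R by rewrite subr_gt0 lt_neqAle eq_sym pE.
have omt0 := om_ge0 t.
have mp0 : (0 < m `^ p)%R by rewrite powR_gt0.
pose B := (m `^ p * om t + e)%R.
have B0 : (0 < B)%R by rewrite ltr_wpDl// mulr_ge0// ltW.
(* [Y] is the size of the integral for which the price is exactly [B]. *)
pose Y := ((m `^ p / B) `^ s)%R.
have mB0 : (0 < m `^ p / B)%R by rewrite divr_gt0.
have Y0 : (0 < Y)%R by rewrite powR_gt0.
have Yp : (Y `^ (p - 1) = m `^ p / B)%R by rewrite /Y -powRrM sp powRr1// ltW.
pose Z := \int[leb]_(y in `]-oo, t[) negpow (v y)%:E s.
have sigE : sig t = Z `^ (conj_exp p)^-1 by rewrite sigp.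
have YZ : Y%:E < Z.
  rewrite ltNge; apply/negP => ZY.
  have : sig t <= (Y `^ (conj_exp p)^-1)%:E.
    by rewrite sigE -poweR_EFin; apply: poweR_le => //;
      [rewrite invr_ge0 ltW|exact: int_negpow_ge0].
  move=> /(negpow_le (ltW p0) (sig_ge0 t)); rewrite omE negpowE ?powR_ge0//.
  rewrite gt_eqF ?powR_gt0// lee_fin powRN -powRrM [(_^-1 * p)%R]mulrC pq Yp invf_div.
  by rewrite ler_pdivrMr// mulrC /B gerDl leNgt e0.
pose vn (n : nat) y := Num.max (v y) (n.+1%:R^-1)%R.
have vn0 n y : (0 < vn n y)%R by rewrite lt_max invr_gt0 ltr0n orbT.
have nvn n : nonneg_measurable (vn n).
  by apply: nnm_max => //; apply: nnm_cst; rewrite invr_ge0.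
pose D (n : nat) := `](- n%:R)%R, t]%classic : set R.
have mD n : mset (D n) by exact: mset_itv.
pose z n y := (vn n y `^ (- s))%R.
have nz n : nonneg_measurable (z n) by exact: nnm_pow.
pose In n := \int[leb]_(y in D n) (z n y)%:E.
have [n YIn] : exists n, Y%:E < In n.
  apply: contrapT => /forallNP h.
  have h' n : In n <= Y%:E by rewrite leNgt; apply/negP; exact: h.
  pose w := (\1_(`]-oo, t]%classic : set R) : R -> R).
  have nw : nonneg_measurable w by apply: nnm_indic; exact: mset_itv.
  have mF := emeas_negpow nv s0.
  have : \int[leb]_y (negpow (v y)%:E s `^ 1 * (w y)%:E) <= Y%:E.
    pose D' (k : nat) := `](- k%:R)%R, +oo[%classic : set R.
    have nzD k := nnmM (nz k) (nnm_indic (mset_itv _ : mset (D' k))).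
    apply: (@fatou_pow 1 w (fun=> w) _ (fun n y => (z n y * \1_(D' n) y)%:E)) => //.
    - by move=> y; exists 0%N.
    - by move=> y; exact: negpow_ge0.
    - by move=> k; exact: (emeas_fin (nzD k)).
    - by move=> k y; rewrite lee_fin (nzD k).1.
    - move=> y a a0; rewrite negpowE ?nv.1// => ay.
      pose k0 := (Num.truncn `|y|).+1.
      have kD k : (k0 <= k)%N -> y \in D' k.
        move=> kk; rewrite inE /D' /= in_itv/= andbT ltrNl.
        apply: le_lt_trans (ler_norm _) _; rewrite normrN.
        by apply: lt_le_trans (truncnS_gt _) _; rewrite ler_nat.
      suff [k1 Hk1] : exists k1, forall k, (k1 <= k)%N -> (a <= z k y)%R.
        exists (maxn k0 k1) => k; rewrite geq_max => /andP[h1 h2].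
        by rewrite lee_fin indicE kD// mulr1 Hk1.
      have inv_le (u : R) (k : nat) : (0 < u)%R -> (Num.truncn u^-1 <= k)%N ->
          (k.+1%:R^-1 <= u)%R.
        move=> u0 uk; rewrite -[leRHS]invrK lef_pV2 ?posrE ?invr_gt0//.
        by apply: ltW (lt_le_trans (truncnS_gt _) _); rewrite ler_nat ltnS.
      have [vy|vy] := eqVneq (v y) 0%R.
        pose u := ((a + 1) `^ (- s^-1))%R.
        have u0 : (0 < u)%R by rewrite powR_gt0// ltr_wpDl.
        exists (Num.truncn u^-1) => k uk; rewrite /z /vn vy max_r ?invr_ge0//.
        apply: (@le_trans _ _ (u `^ (- s))%R).
          by rewrite /u -powRrM mulrNN mulVf ?gt_eqF// powRr1 ?addr_ge0// lerDl.
        have us0 : (0 < u `^ s)%R by exact: powR_gt0.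
        rewrite !powRN lef_pV2 ?posrE ?us0// ?powR_gt0 ?invr_gt0//.
        apply: ge0_ler_powR; rewrite ?nnegrE ?invr_ge0 ?(ltW s0) ?(ltW u0)//.
        exact: inv_le.
      have vy0 : (0 < v y)%R by rewrite lt_neqAle eq_sym vy nv.1.
      exists (Num.truncn (v y)^-1) => k uk.
      move: ay; rewrite (negbTE vy) lte_fin => /ltW ay.
      by rewrite /z /vn max_l// inv_le.
    - move=> k; apply: le_trans (h' k).
      rewrite /In -(int_indic _ (@subsetT _ (D k))).
      apply: le_int => //.
      + by apply: emeasM; [apply: emeas_pow; exact: (emeas_fin (nzD k))|exact: emeas_fin].
      + exact: (emeas_fin (nnmM (nz k) (nnm_indic (mD k)))).
      + by move=> y _; rewrite mule_ge0 ?poweR_ge0 ?lee_fin ?nw.1.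
      move=> y _; rewrite poweRe1; last by rewrite lee_fin (nzD k).1.
      rewrite -EFinM lee_fin -mulrA.
      rewrite ler_wpM2l ?powR_ge0// /w !indicE.
      have [yk|] := boolP (y \in D' k); last by rewrite mul0r.
      have [yt|] := boolP (y \in _); last by rewrite mulr0.
      rewrite mem_set ?mulr1//; move: yk yt; rewrite !inE /D /D' /= !in_itv/= andbT.
      by move=> -> ->.
  rewrite leNgt => /negP; apply; apply: lt_le_trans YZ _.
  have mFw : emeas (fun y => negpow (v y)%:E s `^ 1 * (w y)%:E).
    by apply: emeasM; [exact: emeas_pow|exact: emeas_fin].
  have Fw0 y : 0 <= negpow (v y)%:E s `^ 1 * (w y)%:E.
    by rewrite mule_ge0 ?poweR_ge0 ?lee_fin ?nw.1.
  apply: (@le_trans _ _ (\int[leb]_(y in `]-oo, t[) (negpow (v y)%:E s `^ 1 * (w y)%:E))).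
    apply: (le_int (mset_itv _) mF mFw); first by move=> y _; exact: negpow_ge0.
    move=> y /=; rewrite in_itv/= => yt; rewrite poweRe1 ?negpow_ge0// /w indicE.
    by rewrite mem_set ?mule1//= in_itv/= ltW.
  exact: (le_int_sub (mset_itv _) mset_T mFw Fw0 (@subsetT _ _)).
have Infin : In n < +oo.
  apply: (@le_lt_trans _ _ (\int[leb]_(y in D n) (n.+1%:R^-1 `^ (- s))%:E)).
    apply: le_int => //; [exact: emeas_fin|exact: measurable_cst| |].
      by move=> y _; rewrite lee_fin powR_ge0.
    move=> y _; rewrite lee_fin /z !powRN lef_pV2 ?posrE ?powR_gt0 ?invr_gt0//.
    apply: ge0_ler_powR; rewrite ?nnegrE ?invr_ge0 ?(ltW s0) ?(ltW (vn0 _ _))//.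
    by rewrite /vn le_max lexx orbT.
  rewrite (int_cst _ (mD n)).
  rewrite /D; have [h|h] := leP (- n%:R)%R t.
    by rewrite leb_oc// -EFinM ltry.
  by rewrite set_itv_ge ?measure0 ?mule0 ?ltry// bnd_simp -leNgt ltW.
have InE : In n = (fine (In n))%:E.
  by rewrite fineK// ge0_fin_numE//; apply: integral_ge0 => y _; rewrite lee_fin powR_ge0.
move: YIn; rewrite InE; move: InE; set I := fine _ => InE; rewrite lte_fin => YI.
have I0 : (0 < I)%R by exact: lt_trans YI.
have mI0 : (0 <= m / I)%R by rewrite divr_ge0// ltW.
have nk : nonneg_measurable (fun y => m / I * z n y)%R.
  by apply: nnmM => //; exact: nnm_cst.
have nD := nnm_indic (mD n).
have ng : nonneg_measurable (fun y => m / I * z n y * \1_(D n) y)%R by exact: nnmM.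
exists (fun y => m / I * z n y * \1_(D n) y)%R; split => //.
  rewrite /prim int_indic; last by move=> y /=; rewrite !in_itv/= => /andP[].
  under eq_integral do rewrite EFinM.
  rewrite intZ ?lee_fin//; last 2 first.
  - exact: emeas_fin.
  - by move=> y; rewrite lee_fin powR_ge0.
  by rewrite -/(In n) InE -EFinM divfK// gt_eqF.
apply: (@le_trans _ _ (\int[leb]_y (((m / I) `^ p) * z n y * \1_(D n) y)%:E)).
  apply: le_int => //.
  - exact: (emeas_pv p nv ng).
  - exact: (emeas_fin (nnmM (nnmM (nnm_cst (powR_ge0 _ _)) (nz n)) nD)).
  - by move=> y _; exact: (pv_ge0 p nv (fun y => m / I * z n y * \1_(D n) y)%R).
  move=> y _; rewrite lee_fin indicE; have [_|_] := boolP (y \in D n); last first.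
    by rewrite !mulr0 powR0 ?gt_eqF// mul0r.
  rewrite !mulr1 powRM ?powR_ge0// -mulrA ler_wpM2l ?powR_ge0//.
  apply: (@le_trans _ _ (z n y `^ p * vn n y)%R).
    by rewrite ler_wpM2l ?powR_ge0// /vn le_max lexx.
  rewrite /z -powRrM -[X in (_ * X)%R]powRr1 ?(ltW (vn0 _ _))//.
  rewrite -powRD; last by rewrite (gt_eqF (vn0 _ _)) implybT.
  rewrite (_ : - s * p + 1 = - s)%R//; have := sp; rewrite mulrBr mulr1; lra.
rewrite (int_indic _ (@subsetT _ (D n))).
under eq_integral do rewrite EFinM.
rewrite intZ ?lee_fin ?powR_ge0//; last 2 first.
- exact: emeas_fin.
- by move=> y; rewrite lee_fin powR_ge0.
rewrite -/(In n) InE -EFinM lee_fin -/B.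
rewrite powRM ?invr_ge0 ?(ltW m0) ?(ltW I0)//.
have Ip : (I `^ p = I `^ (p - 1) * I)%R.
  rewrite -[X in (_ = _ * X)%R]powRr1 ?(ltW I0)// -powRD ?subrK//.
  by rewrite (gt_eqF I0) implybT.
have Ip0 : (0 < I `^ (p - 1))%R by rewrite powR_gt0.
have -> : (I^-1 `^ p = (I `^ (p - 1))^-1 * I^-1)%R.
  by rewrite -invfM -Ip -powRN -powR_inv1 ?(ltW I0)// -powRrM mulN1r.
rewrite -!mulrA mulVf ?gt_eqF// mulr1 ler_pdivrMr//.
rewrite mulrC -ler_pdivrMr// -Yp.
by apply: ge0_ler_powR; rewrite ?nnegrE ?(ltW pm0) ?(ltW I0) ?(ltW Y0)// ltW.
Qed.

Lemma sigma_hoelder_sharp : hoelder_sharp p v om.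
Proof.
have [pE|pE] := eqVneq p 1%R; [exact: sigma_hoelder_sharp1|exact: sigma_hoelder_sharp_gt1].
Qed.

End sigma.

(** * Transfer of the inequalities *)
Lemma ereal_between (a : R) (X : \bar R) : a%:E < X -> exists2 b, (a < b)%R & b%:E < X.
Proof.
case: X => [x| |//]; last by exists (a + 1)%R; rewrite ?ltrDl ?ltry.
by rewrite lte_fin => ax; exists ((a + x) / 2)%R; rewrite ?lte_fin; lra.
Qed.

Lemma le_of_le_add (a b k : R) (P : \bar R) :
  b%:E <= P + k%:E -> (k <= b - a)%R -> a%:E <= P.
Proof.
case: P => [P| |//]; last by move=> _ _; exact: leey.
by rewrite -EFinD !lee_fin => h1 h2; lra.
Qed.

Lemma le_mul_add_eps (k : R) (L N : \bar R) : (0 <= k)%R -> 0 <= N ->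
  (forall e, (0 < e)%R -> L <= k%:E * (N + e%:E)) -> L <= k%:E * N.
Proof.
rewrite le_eqVlt => /predU1P[<-|k0] N0 h.
  by have := h 1%R ltr01; rewrite !mul0e.
apply/lee_addgt0Pr => e e0; apply: le_trans (h _ (divr_gt0 e0 k0)) _.
have ek0 : (0 <= e / k)%R by rewrite divr_ge0// ltW.
by rewrite ge0_muleDr// -EFinM mulrC divfK// gt_eqF.
Qed.

Lemma le_poweR_inv (s : R) (X Y : \bar R) : (0 < s)%R -> 0 <= X -> 0 <= Y ->
  (X `^ s^-1 <= Y) = (X <= Y `^ s).
Proof.
move=> s0 X0 Y0; apply/idP/idP => h.
  rewrite -[X](@poweRVK _ s) ?gt_eqF//.
  by apply: poweR_le; rewrite ?poweR_ge0 ?(ltW s0).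
rewrite -[Y](@poweRK _ s) ?gt_eqF//.
by apply: poweR_le; rewrite ?invr_ge0 ?(ltW s0).
Qed.

Lemma prim_trunc_lt f (k : R) (y : R) (a : \bar R) :
  nonneg_measurable f -> (0 <= k)%R -> a < k%:E * prim f y ->
  exists n, forall m, (n <= m)%N -> a < k%:E * prim (trunc m f) y.
Proof.
move=> nf k0.
have kE g : nonneg_measurable g ->
    k%:E * prim g y = \int[leb]_(t in `]-oo, y]) (k%:E * (g t)%:E).
  move=> ng; rewrite /prim intZ//; first exact: emeas_fin.
  by move=> t; rewrite lee_fin ng.1.
rewrite (kE _ nf) => h.
have [||n Hn] := trunc_int_lt nf (mset_itv _) _ _ h.
- exact: measurable_cst.
- by move=> x; rewrite lee_fin.
by exists n => m /Hn; rewrite -(kE _ (trunc_nnm m nf)).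
Qed.

Section implications.
Variables (p q : R) (v w : R -> R) (U : R -> R -> R) (c : R).
Hypothesis p1 : (1 <= p)%R.
Hypothesis q0 : (0 < q)%R.
Hypothesis nv : nonneg_measurable v.
Hypothesis nw : nonneg_measurable w.
Hypothesis rU : regular_kernel_with c U.

Let p0 : (0 < p)%R. Proof. exact: lt_le_trans p1. Qed.
Let r : R := (q / p)%R.
Let r0 : (0 < r)%R. Proof. exact: divr_gt0. Qed.
Let rV : (p / q = r^-1)%R. Proof. by rewrite invf_div. Qed.
Let pr : (p * r = q)%R. Proof. by rewrite mulrC divfK// gt_eqF. Qed.

Definition powker (y x : R) : R := (U y x `^ p)%R.
Local Notation K := powker.
Local Notation om := (om p v).

Let U0 y x : (0 <= U y x)%R. Proof. by case: rU. Qed.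
Let U1 x y1 y2 : (y1 <= y2 -> U y2 x <= U y1 x)%R. Proof. by case: rU => _ _ + _ _; exact. Qed.
Let U2 y x1 x2 : (x1 <= x2 -> U y x1 <= U y x2)%R. Proof. by case: rU => _ _ _ + _; exact. Qed.
Let K0 y x : (0 <= K y x)%R. Proof. exact: powR_ge0. Qed.
Let K1 x y1 y2 : (y1 <= y2 -> K y2 x <= K y1 x)%R.
Proof. by move=> h; apply: ge0_ler_powR; rewrite ?nnegrE ?(ltW p0)// U1. Qed.
Let K2 y x1 x2 : (x1 <= x2 -> K y x1 <= K y x2)%R.
Proof. by move=> h; apply: ge0_ler_powR; rewrite ?nnegrE ?(ltW p0)// U2. Qed.

Lemma powker_regular x y z : (x <= y -> y <= z ->
  K x z <= (2 * c) `^ p * (K x y + K y z))%R.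
Proof.
move=> xy yz; have [c0 _ _ _ reg] := rU.
pose m := Num.max (U x y) (U y z).
have m0 : (0 <= m)%R by rewrite le_max U0.
apply: (@le_trans _ _ ((2 * c * m) `^ p)%R).
  apply: ge0_ler_powR; rewrite ?nnegrE ?(ltW p0) ?mulr_ge0 ?(ltW c0)//.
  apply: le_trans (reg x y z xy yz) _.
  rewrite [(2 * c)%R]mulrC -mulrA ler_wpM2l ?(ltW c0)//.
  have : (U x y <= m)%R by rewrite le_max lexx.
  have : (U y z <= m)%R by rewrite le_max lexx orbT.
  lra.
rewrite powRM ?mulr_ge0 ?(ltW c0)// ler_wpM2l ?powR_ge0// /m /Num.max /powker.
by case: ifP => _; rewrite ?lerDl ?lerDr powR_ge0.
Qed.

Lemma norm_sigmaE f : norm_sigma p v f = \int[leb]_x (f x * om x)%:E.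
Proof. by apply: eq_integral => x _; rewrite -/(sig p v x) omE. Qed.

Lemma supop_le_kop f x : nonneg_measurable f -> supop K f x <= kop K f x.
Proof.
move=> nf; apply: supop_le; first exact: kop_ge0.
move=> y yx; rewrite /prim -intZ; last 4 first.
- exact: mset_itv.
- exact: emeas_fin.
- by move=> t; rewrite lee_fin nf.1.
- by rewrite lee_fin.
apply: (@le_trans _ _ (\int[leb]_(t in `]-oo, y]) (K t x * f t)%:E)).
  apply: le_int => //.
  - by apply: emeasM; [exact: measurable_cst|exact: emeas_fin].
  - exact: (emeas_fin (nnm_Kf K0 K1 x nf)).
  - by move=> t _; rewrite mule_ge0 ?lee_fin ?nf.1.
  - move=> t /=; rewrite in_itv/= => ty.
    by rewrite -EFinM lee_fin ler_wpM2r ?nf.1 ?K1.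
apply: le_int_sub => //.
- exact: (emeas_fin (nnm_Kf K0 K1 x nf)).
- by move=> t; rewrite lee_fin mulr_ge0 ?nf.1.
- by move=> t /=; rewrite !in_itv/= => /le_trans->.
Qed.

Lemma wint_ge0 G (D : set R) (s : R) : 0 <= wint s w G D.
Proof. by apply: integral_ge0 => x _; exact: wint_integrand_ge0. Qed.

Lemma inequality_iii_of_ii C : inequality_ii p q v w U C -> inequality_iii p q v w U C.
Proof.
move=> h f nf; apply: le_trans (h f nf).
change (wint r w (supop K f) setT `^ (p / q) <= wint r w (kop K f) setT `^ (p / q)).
apply: poweR_le; first by rewrite rV invr_ge0 ltW.
  exact: wint_ge0.
apply: (le_wint r0 nw mset_T (supop_homo K0 K1 K2 nf) (kop_homo K0 K1 K2 nf)).
- by move=> x; exact: supop_ge0.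
- by move=> x; exact: supop_le_kop.
Qed.

Lemma wint_le_norm_sigmaE C f : (0 <= C)%R -> nonneg_measurable f ->
  (wint r w (supop K f) setT `^ (p / q) <= C%:E * norm_sigma p v f) =
  (wint r w (supop K f) setT <= (C%:E * \int[leb]_x (f x * om x)%:E) `^ r).
Proof.
move=> C0 nf; rewrite rV norm_sigmaE le_poweR_inv ?wint_ge0//.
rewrite mule_ge0 ?lee_fin//; apply: integral_ge0 => x _.
by rewrite lee_fin mulr_ge0 ?nf.1// om_ge0.
Qed.

Lemma wint_le_norm_pvE C f : (0 <= C)%R -> nonneg_measurable f ->
  (wint q w (supop U f) setT `^ q^-1 <= C%:E * norm_pv p v f) =
  (wint q w (supop U f) setT <= ((C `^ p)%:E * \int[leb]_t (f t `^ p * v t)%:E) `^ r).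
Proof.
move=> C0 nf; have A0 : 0 <= \int[leb]_t (f t `^ p * v t)%:E.
  by apply: integral_ge0 => x _; exact: pv_ge0.
rewrite le_poweR_inv ?wint_ge0//; last first.
  by rewrite mule_ge0 ?lee_fin// poweR_ge0.
congr (_ <= _).
rewrite -pr poweRrM; congr (_ `^ _).
by rewrite poweRM ?lee_fin ?poweR_ge0// poweRVK ?gt_eqF.
Qed.

Lemma wint_scale (k : R) (s : R) G : (0 <= k)%R -> {homo G : x y / (x <= y)%R >-> x <= y} ->
  (forall x, 0 <= G x) ->
  wint s w (fun x => k%:E * G x) setT = (k%:E `^ s) * wint s w G setT.
Proof.
move=> k0 Gh G0; rewrite -intZ ?poweR_ge0//.
- by apply: eq_integral => x _; rewrite poweRM ?lee_fin// muleA.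
- exact: emeas_wint.
- by move=> x; exact: wint_integrand_ge0.
Qed.

(** The error [2 * eta] of the majorization is multiplied by [K y x], which is
   not bounded in [x] and [y]; it is made small only after a value of the
   supremum operator, hence [x] and [y], has been chosen. *)
Lemma inequality_iii_of_i C : (0 <= C)%R -> inequality_i p q v w U C ->
  inequality_iii p q v w U (4 * C `^ p)%R.
Proof.
move=> C0 h f nf.
change (wint r w (supop K f) setT `^ (p / q) <= (4 * C `^ p)%:E * norm_sigma p v f).
rewrite norm_sigmaE; set N := \int[leb]_x _.
have N0 : 0 <= N.
  by apply: integral_ge0 => x _; rewrite lee_fin mulr_ge0 ?nf.1// om_ge0.
have -> : (4 * C `^ p)%:E * N = (2 * C `^ p)%:E * (2%:E * N).
  by rewrite muleA -EFinM; congr (_%:E * _); ring.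
apply: le_mul_add_eps; rewrite ?mulr_ge0 ?powR_ge0 ?mule_ge0// => e e0.
have Ne : 0 <= (2 * C `^ p)%:E * (2%:E * N + e%:E).
  by rewrite mule_ge0 ?adde_ge0 ?mule_ge0 ?lee_fin ?mulr_ge0 ?powR_ge0 ?(ltW e0).
rewrite rV le_poweR_inv ?wint_ge0//.
have om0 := om_ge0 p v; have omn := om_nhomo p1 nv.
have H2 := sigma_hoelder_sharp p1 nv.
pose eta (n : nat) : R := (n.+1%:R^-1)%R.
have eta0 n : (0 < eta n)%R by rewrite invr_gt0.
have /choice[g gP] n := pow_primitive p1 nv om0 omn H2 (trunc_tame n nf) (eta0 n) e0.
have ng n : nonneg_measurable (g n) by case: (gP n).
have Tg_homo n := supop_homo U0 U1 U2 (ng n).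
have Tg0 n x : 0 <= supop U (g n) x by exact: supop_ge0.
have pTg_homo n : {homo (fun x => supop U (g n) x `^ p) : x y / (x <= y)%R >-> x <= y}.
  by move=> x y xy; apply: poweR_le; rewrite ?(ltW p0) ?Tg0 ?Tg_homo.
apply: (@fatou_pow r w (fun=> w) _ (fun n x => 2%:E * supop U (g n) x `^ p)) => //.
- by move=> x; exists 0%N.
- exact/emeas_homo/supop_homo.
- by move=> x; exact: supop_ge0.
- by move=> n; apply: emeasM; [exact: measurable_cst|exact: emeas_homo].
- by move=> n x; rewrite mule_ge0 ?poweR_ge0.
- move=> x a a0 /(supop_lt (_ : 0 <= a%:E))[|y yx]; first by rewrite lee_fin.
  move=> /ereal_between[b ab] /(prim_trunc_lt nf (K0 _ _))[n Hn].
  have Kab : (0 <= 2 * K y x / (b - a))%R.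
    by rewrite divr_ge0 ?mulr_ge0// subr_ge0 ltW.
  exists (maxn n (Num.truncn (2 * K y x / (b - a))%R)) => m.
  rewrite geq_max => /andP[nm km].
  have := Hn m nm.
  have [_ /(_ y) cov _] := gP m.
  move=> /ltW/le_trans/(_ (lee_wpmul2l (_ : 0 <= (K y x)%:E) cov)).
  move=> /(_ _); rewrite lee_fin => /(_ (K0 _ _)).
  rewrite ge0_muleDr ?mule_ge0 ?poweR_ge0 ?lee_fin ?mulr_ge0 ?(ltW (eta0 m))//.
  have bnd : (K y x)%:E * (2%:E * prim (g m) y `^ p) <= 2%:E * supop U (g m) x `^ p.
    rewrite muleCA lee_wpmul2l// /powker -poweR_EFin -poweRM ?lee_fin ?prim_ge0//.
    by apply: poweR_le; rewrite ?(ltW p0) ?mule_ge0 ?lee_fin ?prim_ge0// supop_ge.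
  move=> /le_trans/(_ (leeD2r _ bnd)).
  have Keta : (K y x * (2 * eta m) <= b - a)%R.
    rewrite mulrA /eta ler_pdivrMr// [leRHS]mulrC -ler_pdivrMr ?subr_gt0//.
    rewrite [(K y x * 2)%R]mulrC.
    by apply: ltW (lt_le_trans (truncnS_gt _) _); rewrite ler_nat ltnS.
  by rewrite -EFinM => /le_of_le_add; apply.
move=> n.
change (wint r w (fun x => 2%:E * supop U (g n) x `^ p) setT <=
  ((2 * C `^ p)%:E * (2%:E * N + e%:E)) `^ r).
rewrite wint_scale//; last by move=> x; exact: poweR_ge0.
have -> : wint r w (fun x => supop U (g n) x `^ p) setT = wint q w (supop U (g n)) setT.
  by apply: eq_integral => x _; rewrite -poweRrM pr.
have := h (g n) (ng n).
rewrite -/(prim (g n)) => hg.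
have {}hg : wint q w (supop U (g n)) setT `^ q^-1 <= C%:E * norm_pv p v (g n) by exact: hg.
rewrite wint_le_norm_pvE// in hg.
rewrite EFinM -muleA poweRM ?lee_fin//; last first.
  by rewrite mule_ge0 ?adde_ge0 ?mule_ge0 ?lee_fin ?powR_ge0 ?(ltW e0).
rewrite lee_wpmul2l ?poweR_ge0//; apply: le_trans hg _.
have [_ _ cost] := gP n.
apply: poweR_le; rewrite ?(ltW r0)//.
  rewrite mule_ge0 ?lee_fin ?powR_ge0//; apply: integral_ge0 => x _; exact: pv_ge0.
rewrite lee_wpmul2l ?lee_fin ?powR_ge0//; apply: le_trans cost _.
apply: leeD2r; apply: lee_wpmul2l => //.
apply: (le_int mset_T (emeas_om om0 omn (trunc_nnm n nf)) (emeas_om om0 omn nf)).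
- by move=> x _; rewrite lee_fin mulr_ge0// (trunc_nnm n nf).1.
- by move=> x _; rewrite lee_fin ler_wpM2r// trunc_le.
Qed.

(** The step sizes are normalized so that [(4 * eta n) ^ p = 1 / (n + 1)].
   The constant is [4] from the majorization times [2] from the loss of half
   of the mass at each level. *)
Lemma inequality_i_of_iii C : (0 <= C)%R -> inequality_iii p q v w U C ->
  inequality_i p q v w U (8 * C `^ p^-1)%R.
Proof.
move=> C0 h f nf.
change (wint q w (supop U f) setT `^ q^-1 <= (8 * C `^ p^-1)%:E * norm_pv p v f).
rewrite wint_le_norm_pvE ?mulr_ge0 ?powR_ge0//; set A := \int[leb]_x _.
have A0 : 0 <= A by apply: integral_ge0 => x _; exact: pv_ge0.
have -> : ((8 * C `^ p^-1) `^ p = 4 `^ p * (C * 2 `^ p))%R.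
  rewrite powRM ?powR_ge0// -powRrM mulVf ?gt_eqF// powRr1//.
  by rewrite (_ : 8 = 4 * 2)%R ?powRM// -?natrM//; ring.
have om0 := om_ge0 p v; have omn := om_nhomo p1 nv.
have H1 := sigma_hoelder_bound p1 nv.
pose eta (n : nat) : R := ((n.+1%:R^-1) `^ p^-1 / 4)%R.
have eta0 n : (0 < eta n)%R by rewrite divr_gt0// powR_gt0// invr_gt0.
have etaE n : ((4 * eta n) `^ p = n.+1%:R^-1)%R.
  by rewrite /eta mulrC divfK// -powRrM mulVf ?gt_eqF// powRr1.
have /choice[g gP] n := primitive_pow p1 nv om0 omn H1 (trunc_tame n nf) (eta0 n).
have ng n : nonneg_measurable (g n) by case: (gP n).
have Tg_homo n := supop_homo K0 K1 K2 (ng n).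
have Tg0 n x : 0 <= supop K (g n) x by exact: supop_ge0.
have Tf_homo : {homo (fun x => supop U f x `^ p) : x y / (x <= y)%R >-> x <= y}.
  by move=> x y xy; apply: poweR_le; rewrite ?(ltW p0) ?supop_ge0 ?supop_homo.
have -> : wint q w (supop U f) setT = wint r w (fun x => supop U f x `^ p) setT.
  by apply: eq_integral => x _; rewrite -poweRrM pr.
apply: (@fatou_pow r w (fun=> w) _ (fun n x => (4 `^ p)%:E * supop K (g n) x)) => //.
- by move=> x; exists 0%N.
- exact: emeas_homo.
- by move=> x; exact: poweR_ge0.
- by move=> n; apply: emeasM; [exact: measurable_cst|exact: emeas_homo].
- by move=> n x; rewrite mule_ge0 ?lee_fin ?powR_ge0.
- move=> x a a0 aT.
  have : (a `^ p^-1)%:E < supop U f x.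
    rewrite ltNge; apply/negP => /(poweR_le (ltW p0) (supop_ge0 U0 U1 x nf)).
    rewrite poweR_EFin -powRrM mulVf ?gt_eqF// powRr1//.
    by rewrite leNgt aT.
  move=> /(supop_lt (_ : 0 <= (a `^ p^-1)%:E))[|y yx]; first by rewrite lee_fin powR_ge0.
  move=> /ereal_between[b ab] /(prim_trunc_lt nf (U0 _ _))[n Hn].
  have b0 : (0 <= b)%R by apply: le_trans (ltW ab); exact: powR_ge0.
  have abp : (a < b `^ p)%R.
    rewrite -[ltLHS]powRr1// -[X in (_ `^ X)%R](@mulVf _ p) ?gt_eqF// powRrM.
    by apply: gt0_ltr_powR; rewrite ?nnegrE ?powR_ge0.
  exists (maxn n (Num.truncn (K y x / (b `^ p - a))%R)) => m.
  rewrite geq_max => /andP[nm km].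
  have := Hn m nm.
  move=> /ltW/(poweR_le (ltW p0) (_ : 0 <= b%:E)); rewrite lee_fin => /(_ b0).
  rewrite !poweR_EFin poweRM; [|by rewrite lee_fin|exact: (prim_ge0 y (trunc_nnm m nf))].
  rewrite poweR_EFin -/(powker y x).
  have [_ /(_ y) cov _] := gP m.
  move=> /le_trans/(_ (lee_wpmul2l (_ : 0 <= (K y x)%:E) cov)).
  move=> /(_ _); rewrite lee_fin => /(_ (K0 _ _)).
  rewrite ge0_muleDr ?mule_ge0 ?prim_ge0 ?lee_fin ?powR_ge0//.
  have bnd : (K y x)%:E * ((4 `^ p)%:E * prim (g m) y) <= (4 `^ p)%:E * supop K (g m) x.
    by rewrite muleCA lee_wpmul2l ?lee_fin ?powR_ge0// supop_ge.
  move=> /le_trans/(_ (leeD2r _ bnd)).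
  have Keta : (K y x * (4 * eta m) `^ p <= b `^ p - a)%R.
    rewrite etaE ler_pdivrMr// mulrC -ler_pdivrMr ?subr_gt0//.
    by apply: ltW (lt_le_trans (truncnS_gt _) _); rewrite ler_nat ltnS.
  by rewrite -EFinM => /le_of_le_add; apply.
move=> n.
change (wint r w (fun x => (4 `^ p)%:E * supop K (g n) x) setT <=
  ((4 `^ p * (C * 2 `^ p))%:E * A) `^ r).
rewrite wint_scale ?powR_ge0//.
have hg : wint r w (supop K (g n)) setT `^ (p / q) <= C%:E * norm_sigma p v (g n).
  exact: (h (g n) (ng n)).
rewrite wint_le_norm_sigmaE// in hg.
rewrite EFinM -muleA poweRM ?lee_fin ?powR_ge0//; last first.
  by rewrite mule_ge0 ?lee_fin ?mulr_ge0 ?powR_ge0.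
rewrite lee_wpmul2l ?poweR_ge0//; apply: le_trans hg _.
have cost : \int[leb]_t (g n t * om t)%:E <= (2 `^ p)%:E * A.
  have [_ _ cost] := gP n; apply: (le_trans cost).
  apply: lee_wpmul2l; first by rewrite lee_fin powR_ge0.
  apply: (le_int mset_T (emeas_pv p nv (trunc_nnm n nf)) (emeas_pv p nv nf)).
    by move=> x _; exact: pv_ge0.
  move=> x _; rewrite lee_fin ler_wpM2r ?nv.1//.
  by apply: ge0_ler_powR; rewrite ?nnegrE ?(ltW p0) ?(trunc_nnm n nf).1 ?nf.1 ?trunc_le.
apply: poweR_le; [exact: ltW|apply: mule_ge0|].
- by rewrite lee_fin.
- by apply: integral_ge0 => x _; rewrite lee_fin mulr_ge0 ?(ng n).1.
- by rewrite EFinM -muleA; apply: lee_wpmul2l; [rewrite lee_fin|exact: cost].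
Qed.

(** [(2 * c) ^ p] is the constant of regularity of [U ^ p], and the outer
   factor [2] is the price of adding the concentrated masses to [f]. *)
Definition const_ii : R := (2 * (2 * disc_base ((2 * c) `^ p) r ^+ 2) `^ r^-1)%R.

Lemma const_ii_gt0 : (0 < const_ii)%R.
Proof.
have a0 : (0 < disc_base ((2 * c) `^ p) r)%R.
  rewrite /disc_base mulr_gt0// powR_gt0// mulr_gt0// lt_max ltr01 orbT//.
by rewrite /const_ii mulr_gt0// powR_gt0// mulr_gt0// exprn_gt0.
Qed.

Lemma inequality_ii_of_iii C : (0 <= C)%R -> inequality_iii p q v w U C ->
  inequality_ii p q v w U (const_ii * C)%R.
Proof.
move=> C0 h f nf.
change (wint r w (kop K f) setT `^ (p / q) <= (const_ii * C)%:E * norm_sigma p v f).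
rewrite norm_sigmaE; set N := \int[leb]_x _.
have N0 : 0 <= N.
  by apply: integral_ge0 => x _; rewrite lee_fin mulr_ge0 ?nf.1// om_ge0.
rewrite /const_ii; set a := disc_base _ _; set k := (2 * a ^+ 2)%R.
have k0 : (0 <= k)%R by rewrite mulr_ge0// exprn_even_ge0.
have kr0 : (0 <= k `^ r^-1 * C)%R by rewrite mulr_ge0 ?powR_ge0.
have -> : (2 * k `^ r^-1 * C)%:E * N = (k `^ r^-1 * C)%:E * (2%:E * N).
  by rewrite muleA -EFinM; congr (_%:E * _); ring.
apply: le_mul_add_eps; rewrite ?mule_ge0// => e e0.
have Ne0 : 0 <= 2%:E * N + e%:E by rewrite adde_ge0 ?mule_ge0 ?lee_fin ?(ltW e0).
rewrite rV le_poweR_inv ?wint_ge0 ?mule_ge0 ?lee_fin//.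
rewrite EFinM -muleA poweRM ?lee_fin ?powR_ge0 ?mule_ge0 ?lee_fin//.
rewrite poweR_EFin -powRrM mulVf ?gt_eqF// powRr1//.
apply/lee_addgt0Pr => d d0.
have om0 := om_ge0 p v; have omn := om_nhomo p1 nv.
pose de := Num.min d e.
have de0 : (0 < de)%R by rewrite lt_min d0.
have /choice[g gP] n := kop_supop K0 K1 K2 powker_regular r0 om0 omn
  (trunc_tame n nf) (trunc_tame n nw) de0.
have ng n : nonneg_measurable (g n) by case: (gP n).
apply: (@fatou_pow r w (fun n => trunc n w) _ (fun n x => kop K (trunc n f) x)) => //.
- by move=> n; exact: trunc_nnm.
- exact: trunc_ev.
- exact: (emeas_homo (kop_homo K0 K1 K2 nf)).
- by move=> x; exact: kop_ge0.
- by move=> n; exact: (emeas_homo (kop_homo K0 K1 K2 (trunc_nnm n nf))).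
- by move=> n x; exact: (kop_ge0 K0 x (trunc_nnm n nf)).
- move=> x b b0; rewrite {1}/kop; under eq_integral do rewrite EFinM.
  move=> /(trunc_int_lt nf (mset_itv _) _ _)[||n Hn].
  + by apply: emeas_nhomo => y1 y2 h12; rewrite lee_fin K1.
  + by move=> y; rewrite lee_fin.
  exists n => m nm; apply: ltW; rewrite /kop; under eq_integral do rewrite EFinM.
  exact: Hn.
move=> n; have [_ cost bnd] := gP n; apply: le_trans bnd _.
have nTg := supop_homo K0 K1 K2 (ng n).
have hg : wint r w (supop K (g n)) setT `^ (p / q) <= C%:E * norm_sigma p v (g n).
  exact: (h (g n) (ng n)).
rewrite wint_le_norm_sigmaE// in hg.
apply: leeD; last by rewrite lee_fin ge_min lexx.
rewrite lee_wpmul2l ?lee_fin//.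
apply: (@le_trans _ _ (wint r w (supop K (g n)) setT)).
  apply: (le_int mset_T (emeas_wint r (trunc_nnm n nw) nTg) (emeas_wint r nw nTg)).
  - by move=> x _; apply: wint_integrand_ge0; exact: trunc_nnm.
  - by move=> x _; rewrite lee_wpmul2l ?poweR_ge0// lee_fin trunc_le.
apply: le_trans hg _; apply: poweR_le; rewrite ?(ltW r0)//.
  rewrite mule_ge0 ?lee_fin//; apply: integral_ge0 => x _.
  by rewrite lee_fin mulr_ge0 ?(ng n).1.
rewrite lee_wpmul2l ?lee_fin//; apply: le_trans cost _.
apply: leeD; last by rewrite lee_fin ge_min lexx orbT.
apply: lee_wpmul2l => //.
apply: (le_int mset_T (emeas_om om0 omn (trunc_nnm n nf)) (emeas_om om0 omn nf)).
- by move=> x _; rewrite lee_fin mulr_ge0// (trunc_nnm n nf).1.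
- by move=> x _; rewrite lee_fin ler_wpM2r// trunc_le.
Qed.

End implications.

(** * Best constants *)
Section best.
Variables (A B : R -> Prop).

Lemma best_constant_ge0 : 0 <= best_constant A.
Proof. by apply: le_ereal_inf_tmp => _ [C [C0 _] <-]; rewrite lee_fin. Qed.

(** Every admissible constant for [A] yields one for [B], and
   [C |-> k * C ^ t] is an increasing bijection of the nonnegative reals, so that
   the bound survives in the infimum even if it is not attained.  If no constant is
   admissible for [A], the bound is infinite. *)
Lemma best_constant_transfer (k t : R) : (0 < k)%R -> (0 < t)%R ->
  (forall C, (0 <= C)%R -> A C -> B (k * C `^ t)%R) ->
  best_constant B <= k%:E * best_constant A `^ t.
Proof.
move=> k0 t0 h; rewrite -lee_pdivrMl//.
have X0 : 0 <= best_constant B by apply: le_ereal_inf_tmp => _ [C [C0 _] <-]; rewrite lee_fin.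
have kX0 : 0 <= (k^-1)%:E * best_constant B by rewrite mule_ge0// lee_fin invr_ge0 ltW.
rewrite -le_poweR_inv// ?best_constant_ge0//.
apply: le_ereal_inf_tmp => _ [C [C0 AC] <-].
rewrite le_poweR_inv ?lee_fin// lee_pdivrMl// poweR_EFin -EFinM.
apply: ereal_inf_lbound; exists (k * C `^ t)%R => //; split; last exact: h.
by rewrite mulr_ge0 ?powR_ge0// ltW.
Qed.

End best.

(** Best constants and the transfer lemmas concern nonnegative constants,
   while an inequality may be given with a negative one. *)
Lemma inequality_sign (ineq : R -> Prop) (L N : (R -> R) -> \bar R) :
  (forall C, ineq C = forall f, nonneg_measurable f -> L f <= C%:E * N f) ->
  (forall f, nonneg_measurable f -> 0 <= N f) ->
  (exists C, ineq C) -> exists2 C, (0 <= C)%R & ineq C.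
Proof.
move=> E N0 [C hC]; exists `|C|%R => //; rewrite E => f nf.
move: hC; rewrite E => /(_ f nf)/le_trans; apply.
by rewrite lee_wpmul2r ?N0// lee_fin ler_norm.
Qed.

End base.

Theorem theorem3p8 (R : realType) (p q : R) (hp : (1 <= p)%R) (hq : (0 < q)%R) :
  (forall (v w : R -> R) (U : R -> R -> R),
     nonneg_measurable v -> nonneg_measurable w ->
     (forall x : R, \int[leb]_(t in `[x, +oo[) (w t)%:E < +oo) ->
     regular_kernel U ->
     ((exists C1 : R, inequality_i p q v w U C1) <->
      (exists C2 : R, inequality_ii p q v w U C2)) /\
     ((exists C2 : R, inequality_ii p q v w U C2) <->
      (exists C3 : R, inequality_iii p q v w U C3)))
  /\
  (forall c : R, exists c1 c2 : R, (0 < c1)%R /\ (0 < c2)%R /\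
     forall (v w : R -> R) (U : R -> R -> R),
       nonneg_measurable v -> nonneg_measurable w ->
       (forall x : R, \int[leb]_(t in `[x, +oo[) (w t)%:E < +oo) ->
       regular_kernel_with c U ->
       let C1 := best_constant (inequality_i p q v w U) in
       let C2 := best_constant (inequality_ii p q v w U) in
       let C3 := best_constant (inequality_iii p q v w U) in
       equiv_const c1 c2 C1 (C2 `^ p^-1) /\
       equiv_const c1 c2 (C2 `^ p^-1) (C3 `^ p^-1)).
Proof.
have p0 : (0 < p)%R by exact: lt_le_trans hp.
have pV0 : (0 < p^-1)%R by rewrite invr_gt0.
split.
  move=> v w U nv nw _ [c rU].
  have pvN f : nonneg_measurable f -> 0 <= norm_pv p v f by move=> _; exact: poweR_ge0.
  have sgN f : nonneg_measurable f -> 0 <= norm_sigma p v f.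
    move=> nf; rewrite (norm_sigmaE hp nv); apply: integral_ge0 => x _.
    by rewrite lee_fin mulr_ge0 ?nf.1 ?om_ge0.
  have i3 : (exists C, inequality_i p q v w U C) -> exists C, inequality_iii p q v w U C.
    move=> /(inequality_sign (fun=> erefl) pvN)[C C0 hC].
    by exists (4 * C `^ p)%R; exact: (inequality_iii_of_i hp hq nv nw rU C0 hC).
  have i31 : (exists C, inequality_iii p q v w U C) -> exists C, inequality_i p q v w U C.
    move=> /(inequality_sign (fun=> erefl) sgN)[C C0 hC].
    by exists (8 * C `^ p^-1)%R; exact: (inequality_i_of_iii hp hq nv nw rU C0 hC).
  have i32 : (exists C, inequality_iii p q v w U C) -> exists C, inequality_ii p q v w U C.
    move=> /(inequality_sign (fun=> erefl) sgN)[C C0 hC].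
    by exists (const_ii p q c * C)%R; exact: (inequality_ii_of_iii hp hq nv nw rU C0 hC).
  have i23 : (exists C, inequality_ii p q v w U C) -> exists C, inequality_iii p q v w U C.
    by move=> [C hC]; exists C; exact: (inequality_iii_of_ii hp hq nw rU hC).
  by split; split; auto.
move=> c; have := const_ii_gt0 p q c; set k := const_ii p q c => k0.
pose T := (8 + (4 * k) `^ p^-1)%R.
have T8 : (8 <= T)%R by rewrite lerDl powR_ge0.
have T0 : (0 < T)%R by apply: lt_le_trans T8.
have kT : (k `^ p^-1 <= T)%R.
  apply: (@le_trans _ _ ((4 * k) `^ p^-1)%R); last by rewrite lerDr.
  have k4 : (k <= 4 * k)%R by rewrite ler_peMl ?(ltW k0)// ler1n.
  apply: ge0_ler_powR; rewrite ?nnegrE; [exact: ltW|exact: ltW| |exact: k4].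
  exact: le_trans (ltW k0) k4.
exists T^-1%R, T; split; [by rewrite invr_gt0|split => //].
move=> v w U nv nw _ rU C1 C2 C3.
have h1 : C1 <= 8%:E * C3 `^ p^-1.
  apply: best_constant_transfer => // C C0 hC.
  exact: (inequality_i_of_iii hp hq nv nw rU C0 hC).
have h3 : C3 <= 4%:E * C1 `^ p.
  apply: best_constant_transfer => // C C0 hC.
  exact: (inequality_iii_of_i hp hq nv nw rU C0 hC).
have h2 : C2 <= k%:E * C3.
  rewrite -[C3]poweRe1 ?best_constant_ge0//.
  apply: best_constant_transfer => // C C0 hC; rewrite powRr1//.
  exact: (inequality_ii_of_iii hp hq nv nw rU C0 hC).
clearbody k.
have h23 : C3 <= 1%:E * C2.
  rewrite -[C2]poweRe1 ?best_constant_ge0//.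
  apply: best_constant_transfer => // C C0 hC; rewrite powRr1// mul1r.
  exact: (inequality_iii_of_ii hp hq nw rU hC).
rewrite mul1e in h23.
have C10 : 0 <= C1 by exact: best_constant_ge0.
have C20 : 0 <= C2 by exact: best_constant_ge0.
have C30 : 0 <= C3 by exact: best_constant_ge0.
clearbody C1 C2 C3.
have root X Y : 0 <= X -> X <= Y -> X `^ p^-1 <= Y `^ p^-1.
  by move=> X0 XY; apply: poweR_le; rewrite ?(ltW pV0).
have up (a : R) X : 0 <= X -> (a <= T)%R -> a%:E * X <= T%:E * X.
  by move=> X0 aT; rewrite lee_wpmul2r// lee_fin.
have D32 : C3 `^ p^-1 <= C2 `^ p^-1 by exact: root.
have D23 : C2 `^ p^-1 <= T%:E * C3 `^ p^-1.
  apply: le_trans (root _ _ C20 h2) _; rewrite poweRM ?lee_fin ?(ltW k0)//.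
  by rewrite poweR_EFin; apply: up; rewrite ?poweR_ge0.
have D21 : C2 `^ p^-1 <= T%:E * C1.
  have : C2 <= (4 * k)%:E * C1 `^ p.
    apply: le_trans h2 _; rewrite [(4 * k)%R]mulrC EFinM -muleA.
    by apply: lee_wpmul2l; [rewrite lee_fin ltW|exact: h3].
  move=> /(root _ _ C20)/le_trans; apply; rewrite poweRM ?poweR_ge0//; last first.
    by rewrite lee_fin mulr_ge0// ltW.
  rewrite poweRK ?gt_eqF// poweR_EFin; apply: up => //.
  by rewrite lerDr.
split; split.
- rewrite lee_pdivrMl//; apply: le_trans h1 _.
  apply: le_trans (up _ _ _ T8) _; rewrite ?poweR_ge0//.
  by rewrite lee_wpmul2l// lee_fin ltW.
- exact: D21.
- by rewrite lee_pdivrMl.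
- apply: le_trans D32 _; rewrite -[leLHS]mul1e; apply: up; rewrite ?poweR_ge0//.
  by apply: le_trans T8; rewrite ler1n.
Qed.
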